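(* Let $k$ be a field, $S=k[x_1,\ldots,x_n]$, and let $d\ge 2$ be an integer. Let $u=x_1^{a_1}\cdots x_n^{a_n}$ with $a_1>0$ and $v=x_1^{b_1}\cdots x_n^{b_n}$ be monomials of degree $d$ with $u\ge_{lex} v$, such that $I=(\mathcal L(u,v))$ is a completely lexsegment ideal. Then $I$ has a linear resolution if and only if $I$ has linear quotients.
   Context: Monomials are ordered lexicographically with $x_1>x_2>\cdots>x_n$. Let $\mathcal M_d$ be the set of monomials of degree $d$ of $S$. For $u,v\in\mathcal M_d$ with $u\ge_{lex}v$, the lexsegment determined by $u$ and $v$ is $\mathcal L(u,v)=\{w\in\mathcal M_d : u\ge_{lex}w\ge_{lex}v\}$, and $(\mathcal L(u,v))$ is the ideal of $S$ it generates. The shadow of a set $\mathcal L$ of monomials is $\mathrm{Shad}(\mathcal L)=\{x_iw : w\in\mathcal L,\ 1\le i\le n\}$, and $\mathrm{Shad}^i(\mathcal L)=\mathrm{Shad}(\mathrm{Shad}^{i-1}(\mathcal L))$. A lexsegment $\mathcal L$ is called completely lexsegment if all its iterated shadows $\mathrm{Shad}^i(\mathcal L)$ are lexsegments; a completely lexsegment ideal is an ideal generated by a completely lexsegment. A monomial ideal has linear quotients if its minimal monomial generators can be ordered $u_1,\ldots,u_m$ such that for every $i\ge 2$ the colon ideal $(u_1,\ldots,u_{i-1}):u_i$ is generated by a subset of the variables. An ideal $I$ generated in degree $d$ has a linear resolution if $\mathrm{Tor}^S_i(I,k)_{i+j}=0$ for all $i$ and all $j\ne d$. *)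

(* Defs.v *)
From HB Require Import structures.
From mathcomp Require Import all_boot all_order all_algebra.
From mathcomp Require Export mpoly.

Set Implicit Arguments.
Unset Strict Implicit.
Unset Printing Implicit Defensive.

Import Order.TTheory GRing.Theory Num.Theory.
Local Open Scope ring_scope.

Section Monomials.
Variable n : nat.
Implicit Types (m u v w : 'X_{1..n}) (L : 'X_{1..n} -> Prop).

(* Plain lexicographic order on exponent vectors, so that x_1 > ... > x_n.
   The canonical order on 'X_{1..n} compares total degrees first; the two agree
   on monomials of equal degree. *)
Definition lexle m1 m2 : bool := ((m1 : seqlexi nat) <= (m2 : seqlexi nat))%O.

Definition lexseg (d : nat) u v : 'X_{1..n} -> Prop :=
  fun w => [/\ mdeg w = d, lexle w u & lexle v w].

Definition is_lexseg L : Prop :=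
  exists (d : nat) u v,
    [/\ mdeg u = d, mdeg v = d, lexle v u & forall w, L w <-> lexseg d u v w].

Definition shad L : 'X_{1..n} -> Prop :=
  fun m => exists (i : 'I_n) w, L w /\ m = (U_(i) + w)%MM.

(* The case i = 0 says that L itself is a lexsegment. *)
Definition completely_lexseg L : Prop := forall i, is_lexseg (iter i shad L).

End Monomials.

Section Ideals.
Variables (k : fieldType) (n : nat).
Local Notation S := {mpoly k[n]}.
Implicit Types (I J G : S -> Prop).

Definition gen_ideal G : S -> Prop := fun f =>
  exists s : seq (S * S),
    (forall p, p \in s -> G p.2) /\ f = \sum_(p <- s) p.1 * p.2.

Definition mon_ideal (L : 'X_{1..n} -> Prop) : S -> Prop :=
  gen_ideal (fun g => exists m, L m /\ g = 'X_[m]).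

Definition var_ideal (V : {set 'I_n}) : S -> Prop :=
  gen_ideal (fun g => exists i, i \in V /\ g = 'X_i).

Definition colon_mon J (u : 'X_{1..n}) : S -> Prop := fun f => J (f * 'X_[u]).

Definition completely_lexseg_ideal I : Prop :=
  exists L, completely_lexseg L /\ (forall f, I f <-> mon_ideal L f).

Definition min_mon_gen I (m : 'X_{1..n}) : Prop :=
  I 'X_[m] /\ (forall m', I 'X_[m'] -> (m' <= m)%MM -> m' = m).

Definition linear_quotients I : Prop :=
  exists s : seq 'X_{1..n},
    [/\ uniq s,
        forall m, m \in s <-> min_mon_gen I m
      & forall i, (0 < i < size s)%N ->
          exists V : {set 'I_n}, forall f,
            colon_mon (mon_ideal (fun m => m \in take i s)) (nth 0%MM s i) f
              <-> var_ideal V f].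

(* Degrees are integers: p is zero or homogeneous of degree z, hence zero if
   z < 0. *)
Definition zhomog (z : int) (p : S) : Prop :=
  forall m, m \in msupp p -> (mdeg m)%:Z = z.

(* A graded free resolution ... -> F_1 -> F_0 -> I -> 0 by finitely generated
   free modules. F_i is the module of row vectors of length [res_rank i], with
   basis vectors in the degrees [res_deg i] (internal degrees in int, as
   resolutions are not assumed minimal); maps act by right multiplication. *)
Record graded_free_resolution I := GradedFreeResolution {
  res_rank : nat -> nat;
  res_deg : forall i, 'I_(res_rank i) -> int;
  res_aug : 'cV[S]_(res_rank 0);
  res_diff : forall i, 'M[S]_(res_rank i.+1, res_rank i);
  res_aug_homog : forall a, zhomog (res_deg a) (res_aug a 0);
  res_diff_homog : forall i a b,
    zhomog (res_deg a - res_deg b) (res_diff i a b);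
  res_aug_image : forall f,
    I f <-> exists w : 'rV[S]_(res_rank 0), f = (w *m res_aug) 0 0;
  res_exact0 : forall w : 'rV[S]_(res_rank 0),
    w *m res_aug = 0 <-> exists w', w = w' *m res_diff 0;
  res_exactS : forall i (w : 'rV[S]_(res_rank i.+1)),
    w *m res_diff i = 0 <-> exists w', w = w' *m res_diff i.+1
}.

Section Tor.
Variables (I : S -> Prop) (F : graded_free_resolution I).

(* F_i (x)_S k is the space of row vectors over k, where k = S/(x_1, ..., x_n);
   the induced differential keeps the constant terms of the entries. *)
Definition tensor_diff i : 'M[k]_(res_rank F i.+1, res_rank F i) :=
  map_mx (mcoeff 0%MM) (res_diff F i).

Definition in_degree i (z : int) (c : 'rV[k]_(res_rank F i)) : Prop :=
  forall b, res_deg (g := F) b != z -> c 0 b = 0.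

Definition tensor_cycle i : 'rV[k]_(res_rank F i) -> Prop :=
  match i with
  | 0 => fun=> True
  | j.+1 => fun c => c *m tensor_diff j = 0
  end.

Definition tensor_boundary i (z : int) (c : 'rV[k]_(res_rank F i)) : Prop :=
  exists c' : 'rV[k]_(res_rank F i.+1),
    in_degree z c' /\ c = c' *m tensor_diff i.

(* Tor_i^S(I, k)_z = H_i(F (x)_S k)_z = 0. *)
Definition tor_zero (i : nat) (z : int) : Prop :=
  forall c : 'rV[k]_(res_rank F i),
    in_degree z c -> tensor_cycle c -> tensor_boundary z c.

End Tor.

(* Tor is computed from a graded free resolution of I. The choice of F is
   immaterial, and one exists whenever I is a homogeneous ideal. *)
Definition linear_resolution I (d : nat) : Prop :=
  exists F : graded_free_resolution I,
    forall (i : nat) (j : int), j != d%:Z -> tor_zero F i (i%:Z + j).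

End Ideals.

(* Main.v *)
(** If [f_1, ..., f_q] generate a graded module with linear quotients, say
    [(f_1, ..., f_(j-1)) : f_j = (x_i, i in V_j)], then the syzygies
    [x_i e_j - (earlier terms)], [i in V_j], generate the syzygy module and,
    ordered by [(j, i)], have linear quotients again, with colon ideals
    [(x_i', i' in V_j, i' < i)]. Iterating yields a linear resolution.

    Conversely, put [a = u_1] and [b = v_1]. If [a = b], complete lexsegments are
    all of the degree [d] monomials with [x_1]-exponent [a]. If [b < a], either
    [b + 1 < a], or a linear resolution forces [x_1 y / x_M <= u] for all [y < v]
    with [x_1]-exponent [b], where [x_M] is the last variable of [y]: for the
    largest [y] violating this, the Koszul boundary of
    [(x_1 y / x_M) e_2 /\ ... /\ e_M] is a nonzero class in
    [Tor_(M-2)(I, k)_(d+M-1)]. In all these cases sorting the generators by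
    increasing [x_1]-exponent, then lexicographically decreasing, gives linear
    quotients. In the code the variable [x_1] has index [ord0]. *)

Require Import Defs.
From HB Require Import structures.
From mathcomp Require Import all_boot all_order all_algebra.
From mathcomp Require Import zify.
From Stdlib Require Import ClassicalEpsilon.

Set Implicit Arguments.
Unset Strict Implicit.
Unset Printing Implicit Defensive.

(** * Monomial ideals and homogeneous components *)

Section MonomialIdeals.
Import GRing.Theory.
Local Open Scope ring_scope.
Variables (k : fieldType) (n : nat).
Local Notation S := {mpoly k[n]}.
Implicit Types (G P : S -> Prop) (L : 'X_{1..n} -> Prop) (f g p : S).
Implicit Types (m l : 'X_{1..n}) (V W : {set 'I_n}).

Lemma gen_ideal_ind G P :
  P 0 -> (forall f g, P f -> P g -> P (f + g)) ->
  (forall p g, G g -> P (p * g)) -> forall f, gen_ideal G f -> P f.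
Proof.
move=> P0 PD PM f [s [Gs ->]].
elim: s Gs => [|q s IHs] Gs; first by rewrite big_nil.
rewrite big_cons; apply: PD; first by apply: PM; apply: Gs; rewrite mem_head.
by apply: IHs => p ps; apply: Gs; rewrite inE ps orbT.
Qed.

Lemma gen_ideal0 G : gen_ideal G 0.
Proof. by exists [::]; split=> //; rewrite big_nil. Qed.

Lemma gen_idealD G f g : gen_ideal G f -> gen_ideal G g -> gen_ideal G (f + g).
Proof.
move=> [s [Gs ->]] [t [Gt ->]]; exists (s ++ t); split; last by rewrite big_cat.
by move=> p; rewrite mem_cat => /orP[/Gs|/Gt].
Qed.

Lemma gen_idealM G p f : gen_ideal G f -> gen_ideal G (p * f).
Proof.
move=> [s [Gs ->]]; exists [seq (p * q.1, q.2) | q <- s]; split.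
  by move=> _ /mapP[q qs ->]; apply: Gs qs.
by rewrite big_map mulr_sumr; apply: eq_bigr => q _; rewrite mulrA.
Qed.

Lemma mem_gen_ideal G g : G g -> gen_ideal G g.
Proof.
move=> Gg; exists [:: (1, g)]; split; last by rewrite big_seq1 mul1r.
by move=> p; rewrite inE => /eqP ->.
Qed.

Lemma gen_ideal_sum G (T : finType) (A : pred T) (F : T -> S) :
  (forall i, A i -> gen_ideal G (F i)) -> gen_ideal G (\sum_(i | A i) F i).
Proof.
move=> GF; elim/big_rec: _ => [|i f Ai Gf]; first exact: gen_ideal0.
by apply: gen_idealD => //; apply: GF.
Qed.

Lemma gen_idealZ G c f : gen_ideal G f -> gen_ideal G (c *: f).
Proof. by rewrite -mul_mpolyC; apply: gen_idealM. Qed.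

Lemma mcoeff_mulX l p m :
  (p * 'X_[l])@_m = if (l <= m)%MM then p@_(m - l)%MM else 0.
Proof.
case: ifP => [lm|/negP lm]; first by rewrite -{1}(submK lm) addmC mcoeffMX.
apply: memN_msupp_eq0; rewrite (perm_mem (msuppMX _ _)).
apply/mapP => -[m' _ def_m]; apply: lm; rewrite def_m.
by rewrite ?lem_addr ?lem_addl.
Qed.

Lemma msupp_mulX l p m :
  m \in msupp (p * 'X_[l]) -> (l <= m)%MM /\ (m - l)%MM \in msupp p.
Proof. by rewrite !mcoeff_msupp mcoeff_mulX; case: ifP => //; rewrite eqxx. Qed.

Lemma mon_idealP L f :
  mon_ideal L f <-> (forall m, m \in msupp f -> exists l, L l /\ (l <= m)%MM).
Proof.
split.
  move: f; apply: gen_ideal_ind => [m|f g Lf Lg m|p _ [l [Ll ->]] m].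
  - by rewrite msupp0.
  - by move/msuppD_le; rewrite mem_cat => /orP[/Lf|/Lg].
  - by case/msupp_mulX => lm _; exists l.
move=> Lf; rewrite [f]mpolyE big_seq.
elim/big_rec: _ => [|m g mf Lg]; first exact: gen_ideal0.
apply: gen_idealD => //; apply: gen_idealZ.
have [l [Ll lm]] := Lf _ mf; rewrite -(submK lm) mpolyXD.
by apply: gen_idealM; apply: mem_gen_ideal; exists l.
Qed.

Lemma mon_idealX L m : mon_ideal (k := k) L 'X_[m] <-> exists l, L l /\ (l <= m)%MM.
Proof.
split=> [/mon_idealP|Lm]; first by apply; rewrite msuppX mem_head.
by apply/mon_idealP => m'; rewrite msuppX inE => /eqP ->.
Qed.

Lemma eq_mon_ideal L L' :
  (forall m, L m <-> L' m) -> forall f, mon_ideal L f <-> mon_ideal L' f.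
Proof.
move=> LL' f; split=> /mon_idealP Lf; apply/mon_idealP => m /Lf [l [/LL' Ll lm]];
  by exists l.
Qed.

Lemma var_idealP V f :
  var_ideal V f <-> (forall m, m \in msupp f -> exists i, i \in V /\ (0 < m i)%N).
Proof.
split=> [Vf m mf|Vf].
  suff /mon_idealP/(_ _ mf) [l [[i [iV ->]]]] :
    mon_ideal (fun l => exists i, i \in V /\ l = U_(i)%MM) f.
    by rewrite lep1mP -lt0n => mi; exists i.
  move: f Vf {m mf}; apply: gen_ideal_ind.
  - exact: gen_ideal0.
  - exact: gen_idealD.
  - move=> p _ [i [iV ->]]; apply: gen_idealM; apply: mem_gen_ideal.
    by exists U_(i)%MM; split=> //; exists i.
rewrite [f]mpolyE big_seq.
elim/big_rec: _ => [|m g mf Vg]; first exact: gen_ideal0.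
apply: gen_idealD => //; apply: gen_idealZ.
have [i [iV mi]] := Vf _ mf.
have lm : (U_(i) <= m)%MM by rewrite lep1mP -lt0n.
rewrite -(submK lm) mpolyXD; apply: gen_idealM; apply: mem_gen_ideal.
by exists i.
Qed.

Lemma var_ideal_sum V f :
  var_ideal V f -> exists g : 'I_n -> S, f = \sum_(i in V) g i * 'X_i.
Proof.
move: f; apply: gen_ideal_ind.
- by exists (fun=> 0); rewrite big1 // => i _; rewrite mul0r.
- move=> _ _ [g ->] [h ->]; exists (fun i => g i + h i).
  by rewrite -big_split; apply: eq_bigr => i _; rewrite mulrDl.
- move=> p _ [i [iV ->]]; exists (fun j => if j == i then p else 0).
  rewrite (bigD1 i) //= eqxx big1 ?addr0 // => j /andP[_ /negbTE ->].
  by rewrite mul0r.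
Qed.

(** Multiplying by ['X_i] changes exponents only at [i], outside [V], so a variable of [V] dividing
    the shifted monomial already divides the original one. *)
Lemma var_ideal_cancelX V i f : i \notin V -> var_ideal V (f * 'X_i) -> var_ideal V f.
Proof.
move=> iV /var_idealP Vf; apply/var_idealP => m mf.
have [|j [jV]] := Vf (m + U_(i))%MM.
  rewrite mcoeff_msupp mcoeff_mulX lem_addl addmK.
  by rewrite -mcoeff_msupp.
rewrite mnmDE mnm1E; case: eqP => [ij|_]; first by rewrite ij jV in iV.
by rewrite addn0 => mj; exists j.
Qed.

Lemma mem_var_ideal V i : i \in V -> var_ideal (k := k) V 'X_i.
Proof. by move=> iV; apply: mem_gen_ideal; exists i. Qed.

End MonomialIdeals.

(** * Homogeneous components of polynomials *)

Section Homogeneous.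
Import GRing.Theory.
Local Open Scope ring_scope.
Variables (k : fieldType) (n : nat).
Local Notation S := {mpoly k[n]}.
Implicit Types (p q : S) (z e : int).

Definition hcomp z p : S :=
  \sum_(m <- msupp p | (mdeg m)%:Z == z) p@_m *: 'X_[m].

Lemma mcoeff_hcomp z p m :
  (hcomp z p)@_m = if (mdeg m)%:Z == z then p@_m else 0.
Proof.
rewrite /hcomp -big_filter raddf_sum /=; set s := filter _ _.
rewrite (eq_bigr (fun m' => p@_m' *+ (m' == m))); last first.
  by move=> m' _; rewrite mcoeffZ mcoeffX mulr_natr.
have s_uniq : uniq s by rewrite filter_uniq ?msupp_uniq.
have := mem_filter (fun m => (mdeg m)%:Z == z) m (msupp p); rewrite -/s.
have [ms|ms] := boolP (m \in s).
  case/esym/andP => -> _; rewrite (bigD1_seq m) //= eqxx big1 ?addr0 //.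
  by move=> m' /negbTE ->.
move=> mz; rewrite big_seq big1 => [|m' m's]; last first.
  by case: eqP => // mm'; rewrite -mm' m's in ms.
by case: ifP mz => // _ /esym/negbT /memN_msupp_eq0 ->.
Qed.

Lemma zhomogP z p : zhomog z p <-> (forall m, p@_m != 0 -> (mdeg m)%:Z = z).
Proof. by split=> hp m; have := hp m; rewrite mcoeff_msupp. Qed.

Lemma zhomog_hcomp z p : zhomog z (hcomp z p).
Proof. by apply/zhomogP => m; rewrite mcoeff_hcomp; case: ifP => [/eqP//|]; rewrite eqxx. Qed.

Lemma hcomp_zhomog z p : zhomog z p -> hcomp z p = p.
Proof.
move=> /zhomogP hp; apply/mpolyP => m; rewrite mcoeff_hcomp; case: eqP => // mz.
by have [//|/hp] := eqVneq p@_m 0.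
Qed.

Lemma zhomog0 z : zhomog z (0 : S).
Proof. by move=> m; rewrite msupp0. Qed.

Lemma zhomogD z p q : zhomog z p -> zhomog z q -> zhomog z (p + q).
Proof. by move=> hp hq m /msuppD_le; rewrite mem_cat => /orP[/hp|/hq]. Qed.

Lemma zhomogN z p : zhomog z p -> zhomog z (- p).
Proof. by move=> hp m; rewrite (perm_mem (msuppN p)) => /hp. Qed.

Lemma zhomog_sum z (T : Type) (r : seq T) (A : pred T) (F : T -> S) :
  (forall i, A i -> zhomog z (F i)) -> zhomog z (\sum_(i <- r | A i) F i).
Proof.
by move=> hF; elim/big_rec: _ => [|i p Ai]; [apply: zhomog0|apply/zhomogD/hF].
Qed.

Lemma zhomogM z e p q : zhomog z p -> zhomog e q -> zhomog (z + e) (p * q).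
Proof.
move=> hp hq m mpq.
have /allpairsP [[m1 m2] [/= /hp <- /hq <- ->]] := msuppM_le mpq.
by rewrite mdegD PoszD.
Qed.

Lemma zhomogX m : zhomog (mdeg m) ('X_[m] : S).
Proof. by move=> m'; rewrite msuppX inE => /eqP ->. Qed.

Lemma zhomogXU i : zhomog 1 ('X_i : S).
Proof. by have := @zhomogX U_(i)%MM; rewrite mdeg1. Qed.

Lemma zhomog_signM z (b : nat) p : zhomog z p -> zhomog z ((-1) ^+ b * p).
Proof.
rewrite -signr_odd; case: odd; rewrite ?expr0 ?expr1 ?mul1r // mulN1r.
exact: zhomogN.
Qed.

Lemma hcomp_is_additive z : additive (hcomp z).
Proof.
move=> p q; apply/mpolyP => m; rewrite !(mcoeff_hcomp, mcoeffB).
by case: ifP => //; rewrite subr0.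
Qed.

HB.instance Definition _ z := GRing.isAdditive.Build _ _ _ (hcomp_is_additive z).

(** A homogeneous factor shifts degrees by exactly [e], so the part of [p] outside degree [z]
    contributes nothing in degree [z + e]. *)
Lemma hcompMr z e p q : zhomog e q -> hcomp (z + e) (p * q) = hcomp z p * q.
Proof.
move=> hq; rewrite -{1}[p](subrK (hcomp z p)) mulrDl raddfD /=.
rewrite [X in _ + X]hcomp_zhomog; last by apply: zhomogM => //; apply: zhomog_hcomp.
suff -> : hcomp (z + e) ((p - hcomp z p) * q) = 0 by rewrite add0r.
apply/mpolyP => m.
rewrite mcoeff_hcomp mcoeff0; case: eqP => // mze.
apply: memN_msupp_eq0; apply/negP => /msuppM_le /allpairsP [[m1 m2] /=].
case=> m1p /hq def_e def_m; move: m1p mze.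
rewrite mcoeff_msupp mcoeffB mcoeff_hcomp def_m mdegD PoszD def_e => m1p.
by move/addIr => m1z; rewrite m1z eqxx subrr eqxx in m1p.
Qed.

Lemma zhomog_mcoeff0 z p : zhomog z p -> z != 0 -> p@_0%MM = 0.
Proof.
move=> hp z0; apply: memN_msupp_eq0; apply: contra z0 => /hp <-.
by rewrite mdeg0.
Qed.

End Homogeneous.

(** * Iterated syzygies of linear quotients *)

Lemma leq_of_lex_key N a b i j :
  j < N -> a * N + i <= b * N + j -> a <= b.
Proof.
move=> jN ab; rewrite leqNgt; apply/negP => ba.
by have := leq_mul ba (leqnn N); rewrite mulSn; lia.
Qed.

Section LinearQuotientMatrices.
Import GRing.Theory.
Local Open Scope ring_scope.
Variables (k : fieldType) (n : nat).
Local Notation S := {mpoly k[n]}.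

Definition homog_mx e q r (M : 'M[S]_(q, r)) := forall a b, zhomog e (M a b).

(* The rows, taken by increasing [rho], have linear quotients. *)
Definition lin_quot_mx q r (M : 'M[S]_(q, r)) (rho : 'I_q -> nat)
    (V : 'I_q -> {set 'I_n}) :=
  injective rho /\ forall j f,
    (exists w : 'rV[S]_q,
        (forall l, (rho j <= rho l)%N -> w 0 l = 0) /\ f *: row j M = w *m M)
    <-> var_ideal (V j) f.

Section Syzygies.
Variables (q r : nat) (e : int) (M : 'M[S]_(q, r)).
Variables (rho : 'I_q -> nat) (V : 'I_q -> {set 'I_n}).
Hypotheses (LQ : lin_quot_mx M rho V) (homM : homog_mx e M).

Let P := [pred p : 'I_q * 'I_n | p.2 \in V p.1].

Let lift_spec (p : 'I_q * 'I_n) (c : 'rV[S]_q) :=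
  p \in P -> [/\ forall l, (rho p.1 <= rho l)%N -> c 0 l = 0,
    'X_p.2 *: row p.1 M = c *m M & forall l, zhomog 1 (c 0 l)].

(** The colon ideal supplies some relation; replacing its coefficients by their degree 1 components
    keeps it valid, because the rows of [M] are homogeneous of degree [e]. *)
Lemma lin_quot_lift : exists c : 'I_q * 'I_n -> 'rV[S]_q,
  forall p, lift_spec p (c p).
Proof.
apply: (fin_all_exists (P := lift_spec)) => -[j i].
have [pP|pNP] := boolP ((j, i) \in P); last by exists 0 => pP; rewrite pP in pNP.
have [w [w0 wM]] := (LQ.2 j 'X_i).2 (mem_var_ideal k pP).
exists (\row_l hcomp 1 (w 0 l)) => _; split=> [l /w0 wl|/=|l]; rewrite ?mxE.
- by rewrite wl raddf0.
- apply/rowP => b; move/rowP/(_ b): wM; rewrite !mxE => def_Xi.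
  have Xi_hom : zhomog (1 + e) ('X_i * M j b).
    by apply: zhomogM => //; apply: zhomogXU.
  rewrite -(hcomp_zhomog Xi_hom) def_Xi raddf_sum.
  by apply: eq_bigr => l _; rewrite mxE; apply: hcompMr.
- exact: zhomog_hcomp.
Qed.

Lemma lin_quot_syzygies : exists q' (M' : 'M[S]_(q', q)) rho' V',
  [/\ lin_quot_mx M' rho' V', homog_mx 1 M'
    & forall w : 'rV[S]_q, w *m M = 0 <-> exists w', w = w' *m M'].
Proof.
have [c c_spec] := lin_quot_lift; have [rho_inj VP] := LQ.
pose sigma p : 'rV[S]_q := 'X_p.2 *: delta_mx 0 p.1 - c p.
pose M' := \matrix_(a < #|P|) sigma (enum_val a).
have sigmaE p l : sigma p 0 l = (if l == p.1 then 'X_p.2 else 0) - c p 0 l.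
  by rewrite !mxE eqxx /=; case: eqP; rewrite ?mulr1 ?mulr0.
have sigma_top p : p \in P -> sigma p 0 p.1 = 'X_p.2.
  by move=> /c_spec [c0 _ _]; rewrite sigmaE eqxx c0 ?subr0.
have sigma_above p l : p \in P -> l != p.1 -> (rho p.1 <= rho l)%N ->
    sigma p 0 l = 0.
  by move=> /c_spec [c0 _ _] /negbTE lp /c0; rewrite sigmaE lp => ->; rewrite subr0.
have sigmaM p : p \in P -> sigma p *m M = 0.
  move=> /c_spec [_ cM _]; rewrite mulmxBl -scalemxAl -rowE.
  by rewrite cM subrr.
have mulM' (h : 'I_q * 'I_n -> S) :
    (\row_a h (enum_val a)) *m M' = \sum_(p in P) h p *: sigma p.
  rewrite mulmx_sum_row [RHS]big_enum_val.
  by apply: eq_bigr => a _; rewrite mxE rowK.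
have pick j (D : {set 'I_n}) (g : 'I_n -> S) : D \subset V j ->
    \sum_(p in P) (if (p.1 == j) && (p.2 \in D) then g p.2 else 0) *: sigma p
    = \sum_(i in D) g i *: sigma (j, i).
  move=> /subsetP DV; rewrite (eq_bigr (fun p =>
    if (p.1 == j) && (p.2 \in D) then g p.2 *: sigma p else 0)); last first.
    by move=> p _; case: ifP => //; rewrite scale0r.
  rewrite -big_mkcondr /= (reindex_onto (fun i => (j, i)) snd) /=; last first.
    by case=> j' i /= /and3P[_ /eqP -> _].
  apply: eq_bigl => i; rewrite inE /= !eqxx andbT /=.
  by case: (boolP (i \in D)) => [/DV ->|]; rewrite ?andbF.
(* Division by leading terms: the coefficient of a syzygy at its top row [l] lies in
   [var_ideal (V l)], so subtracting multiples of the [sigma (l, i)] lowers the bound [B]. The bound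
   on the support of [h] serves the colon ideals below. *)
have gen B (w : 'rV[S]_q) : (forall l, (B <= rho l)%N -> w 0 l = 0) -> w *m M = 0 ->
    exists h : 'I_q * 'I_n -> S, w = \sum_(p in P) h p *: sigma p /\
      forall p, (B <= rho p.1)%N -> h p = 0.
  elim: B w => [|B IHB] w w0 wM.
    exists (fun=> 0); split=> //; rewrite big1 => [|p _]; last by rewrite scale0r.
    by apply/rowP => l; rewrite w0 ?mxE.
  have [/existsP [l /eqP rho_l]|] := boolP [exists l, rho l == B]; last first.
    rewrite negb_exists => /forallP rhoB.
    have [||h [def_w h0]] := IHB w => [l Bl| |].
    - by apply: w0; rewrite ltn_neqAle eq_sym rhoB.
    - by [].
    by exists h; split=> // p /ltnW /h0.
  have : var_ideal (V l) (w 0 l).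
    apply/VP; exists (w 0 l *: delta_mx 0 l - w); split=> [l' Bl'|].
      rewrite !mxE eqxx /=; case: eqP => [->|/eqP l'l]; first by rewrite mulr1 subrr.
      rewrite mulr0 w0 ?subr0 // ltn_neqAle -{1}rho_l (inj_eq rho_inj) eq_sym l'l.
      by rewrite -rho_l.
    by rewrite mulmxBl wM subr0 -scalemxAl -rowE.
  case/var_ideal_sum => g def_wl.
  pose s := \sum_(i in V l) g i *: sigma (l, i).
  have sP i : i \in V l -> (l, i) \in P by [].
  have [||h [def_w h0]] := IHB (w - s).
  - move=> l' Bl'; rewrite !mxE summxE.
    have [->|l'l] := eqVneq l' l.
      apply/eqP; rewrite subr_eq0 def_wl; apply/eqP/eq_bigr => i /sP iV.
      by rewrite mxE (sigma_top _ iV).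
    rewrite w0 ?sub0r.
      rewrite big1 ?oppr0 // => i /sP iV.
      by rewrite mxE (sigma_above _ _ iV) ?mulr0 // rho_l.
    by rewrite ltn_neqAle Bl' andbT -rho_l (inj_eq rho_inj) eq_sym.
  - rewrite mulmxBl wM sub0r mulmx_suml big1 ?oppr0 // => i /sP iV.
    by rewrite -scalemxAl (sigmaM _ iV) scaler0.
  exists (fun p => h p + if (p.1 == l) && (p.2 \in V l) then g p.2 else 0).
  split; last first.
    move=> p Bp; rewrite h0 ?add0r; last exact: ltnW.
    by case: eqP => // pl; rewrite pl rho_l ltnn in Bp.
  under eq_bigr => p _ do rewrite scalerDl.
  by rewrite big_split /= -def_w pick ?subxx // subrK.
(* Since [p.2 < n], this key encodes the lexicographic order on the pairs [(rho p.1, p.2)]. *)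
pose rho' (a : 'I_#|P|) := let p := enum_val a in (rho p.1 * n + p.2)%N.
pose V' (a : 'I_#|P|) :=
  let p := enum_val a in [set i in V p.1 | (i < p.2)%N].
exists #|P|, M', rho', V'; split.
- split=> [a b|a f].
    rewrite /rho'; move: (enum_valP a) (enum_valP b) => _ _ rho_ab.
    apply: enum_val_inj; move: rho_ab.
    case: (enum_val a) (enum_val b) => [j i] [j' i'] /= rho_ab.
    have [lt_i lt_i'] := (ltn_ord i, ltn_ord i').
    have n_gt0 : (0 < n)%N by apply: leq_ltn_trans lt_i.
    congr (_, _).
      apply: rho_inj; have := congr1 (divn^~ n) rho_ab.
      by rewrite !divnMDl // !divn_small // !addn0.
    apply: val_inj; have := congr1 (modn^~ n) rho_ab.
    by rewrite !modnMDl !modn_small.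
  have aP := enum_valP a; rewrite rowK /V'.
  set p := enum_val a in aP *; split.
    move=> [w [w0 fM]].
    (* At position [p.1] the entry of [sigma p] is ['X_p.2], while an earlier syzygy has there a
       smaller variable of [V p.1] or [0]. So [f * 'X_p.2] lies in the ideal of these smaller
       variables, and ['X_p.2] cancels. *)
    apply: (@var_ideal_cancelX _ _ _ p.2); first by rewrite inE ltnn andbF.
    have -> : f * 'X_p.2 = (f *: sigma p) 0 p.1 by rewrite mxE sigma_top.
    rewrite fM mulmx_sum_row summxE; apply: gen_ideal_sum => b _.
    have [/w0 ->|] := leqP (rho' a) (rho' b).
      by rewrite scale0r mxE; apply: gen_ideal0.
    rewrite /rho' /= -/p mxE rowK; move: (enum_valP b).
    set p' := enum_val b => p'P lt_p'p; apply: gen_idealM.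
    have [eq_pp'|ne_pp'] := eqVneq p.1 p'.1.
      rewrite eq_pp' sigma_top //; apply: mem_var_ideal.
      by rewrite inE; apply/andP; split=> //; rewrite eq_pp' ltn_add2l in lt_p'p.
    rewrite sigma_above //; first exact: gen_ideal0.
    exact: leq_of_lex_key (ltn_ord _) (ltnW lt_p'p).
  case/var_ideal_sum => g ->.
  set D := [set i in V p.1 | _] in g *.
  have DV : D \subset V p.1 by apply/subsetP => i; rewrite inE => /andP[].
  have DP i : i \in D -> (p.1, i) \in P by move=> /(subsetP DV).
  (* Each ['X_i *: sigma p - 'X_p.2 *: sigma (p.1, i)] vanishes at position [p.1], so [gen]
     expresses the sum by syzygies attached to rows strictly earlier than [p.1]. *)
  pose w := \sum_(i in D) g i *: ('X_i *: sigma p - 'X_p.2 *: sigma (p.1, i)).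
  have [||h [def_w h0]] := gen (rho p.1) w.
  - have mxE2 x y (s t : 'rV[S]_q) l : (x *: s - y *: t) 0 l = x * s 0 l - y * t 0 l.
      by rewrite !mxE.
    move=> l pl; rewrite summxE big1 // => i /DP iP; rewrite mxE mxE2.
    have [def_l|ne_l] := eqVneq l p.1.
      by rewrite def_l (sigma_top _ aP) (sigma_top _ iP) /= [X in _ - X]mulrC subrr mulr0.
    by rewrite (sigma_above _ _ aP) ?(sigma_above _ _ iP) // !mulr0 subr0 mulr0.
  - rewrite mulmx_suml big1 // => i /DP iP.
    rewrite -scalemxAl mulmxBl -!scalemxAl (sigmaM _ aP) (sigmaM _ iP).
    by rewrite !scaler0 subr0 scaler0.
  exists (\row_b let p' := enum_val b in h p' +
    if (p'.1 == p.1) && (p'.2 \in D) then g p'.2 * 'X_p.2 else 0); split.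
    move=> b; rewrite mxE /rho' /= -/p; set p' := enum_val b => le_pp'.
    rewrite h0 ?add0r.
      case: andP => // -[/eqP eq_p]; rewrite inE => /andP[_].
      by rewrite eq_p leq_add2l leqNgt in le_pp'; rewrite (negbTE le_pp').
    exact: leq_of_lex_key (ltn_ord _) le_pp'.
  pose h' p' := h p' + if (p'.1 == p.1) && (p'.2 \in D) then g p'.2 * 'X_p.2 else 0.
  rewrite (mulM' h') /h'.
  under [RHS]eq_bigr => p' _ do rewrite scalerDl.
  rewrite big_split /= -def_w (pick p.1 D (fun i => g i * 'X_p.2)) //.
  rewrite /w scaler_suml -big_split; apply: eq_bigr => i _ /=.
  by rewrite [g i *: _]scalerBr !scalerA subrK.
- move=> a l; rewrite mxE sigmaE; have [_ _ c1] := c_spec _ (enum_valP a).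
  apply: zhomogD; last exact/zhomogN.
  by case: ifP => _; [apply: zhomogXU|apply: zhomog0].
- move=> w; split=> [wM|[w' ->]]; last first.
    rewrite [w' *m M']mulmx_sum_row mulmx_suml big1 // => a _.
    by rewrite rowK -scalemxAl (sigmaM _ (enum_valP a)) scaler0.
  have [||h [-> _]] := gen (\max_l rho l).+1 w => //.
    by move=> l; rewrite ltnNge leq_bigmax.
  by exists (\row_a h (enum_val a)); rewrite mulM'.
Qed.

End Syzygies.
End LinearQuotientMatrices.

(** * The linear resolution obtained by iterating the syzygy step *)

Section IteratedSyzygies.
Import GRing.Theory.
Local Open Scope ring_scope.
Variables (k : fieldType) (n : nat).
Local Notation S := {mpoly k[n]}.

(** The matrix sizes change at every step, so the iteration runs over records bundling the sizes
    with the matrix. *)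
Record lq_stage := LQStage {
  stage_cols : nat;
  stage_rows : nat;
  stage_mx : 'M[S]_(stage_rows, stage_cols);
  stageP : exists rho V e,
    lin_quot_mx stage_mx rho V /\ homog_mx e stage_mx
}.

Definition next_spec (s : lq_stage) (T : {q : nat & 'M[S]_(q, stage_rows s)}) :=
  [/\ exists rho V, lin_quot_mx (projT2 T) rho V, homog_mx 1 (projT2 T)
    & forall w : 'rV[S]_(stage_rows s),
        w *m stage_mx s = 0 <-> exists w', w = w' *m projT2 T].

Lemma next_exists s : exists T, @next_spec s T.
Proof.
have [rho [V [e [LQ he]]]] := stageP s.
have [q [M [rho' [V' [LQ' h' exM]]]]] := lin_quot_syzygies LQ he.
by exists (existT _ q M); split=> //; exists rho', V'.
Qed.

(** The matrices of a resolution are data, so the syzygy matrix, known only to exist, is picked by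
    indefinite description. *)
Definition next_mx s :=
  proj1_sig (constructive_indefinite_description _ (next_exists s)).

Lemma next_mxP s : next_spec (next_mx s).
Proof. exact: proj2_sig. Qed.

Lemma next_stageP s : exists rho V e,
  lin_quot_mx (projT2 (next_mx s)) rho V /\ homog_mx e (projT2 (next_mx s)).
Proof. by have [[rho [V LQ]] h1 _] := next_mxP s; exists rho, V, 1. Qed.

Definition next_stage s := LQStage (next_stageP s).

Variables (I : S -> Prop) (d q : nat) (M : 'cV[S]_q).
Variables (rho : 'I_q -> nat) (V : 'I_q -> {set 'I_n}).
Hypotheses (LQ : lin_quot_mx M rho V) (homM : homog_mx d M).
Hypothesis genM : forall f, I f <-> exists w : 'rV[S]_q, f = (w *m M) 0 0.

Let stage0 := @LQStage 1 q M
  (ex_intro _ rho (ex_intro _ V (ex_intro _ d%:Z (conj LQ homM)))).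
Let stage i := iter i next_stage stage0.
Let rank i := stage_rows (stage i).
Let diff i : 'M[S]_(rank i.+1, rank i) := stage_mx (stage i.+1).

(** The entries of every syzygy matrix are linear forms, so each differential raises the generator
    degrees by exactly one. *)
Lemma lin_quot_resolution : exists F : graded_free_resolution I,
  forall i b, res_deg (g := F) (i := i) b = i%:Z + d%:Z.
Proof.
have diff_homog i (a : 'I_(rank i.+1)) (b : 'I_(rank i)) :
    zhomog (i.+1%:Z + d%:Z - (i%:Z + d%:Z)) (diff i a b).
  have [_ h1 _] := next_mxP (stage i).
  by have -> : i.+1%:Z + d%:Z - (i%:Z + d%:Z) = 1 by lia.
have aug_homog (a : 'I_(rank 0)) : zhomog (0%:Z + d%:Z) (M a 0).
  by rewrite add0r.
have exact i (w : 'rV[S]_(stage_rows (stage i))) :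
    w *m stage_mx (stage i) = 0 <-> exists w', w = w' *m diff i.
  by have [_ _ ] := next_mxP (stage i).
by exists (@GradedFreeResolution k n I rank (fun i _ => i%:Z + d%:Z) M diff
  aug_homog diff_homog genM (exact 0) (fun i => exact i.+1)).
Qed.

Lemma lin_quot_linear_resolution : linear_resolution I d.
Proof.
have [F degF] := lin_quot_resolution; exists F => i j jd c c_deg _.
(* All basis vectors of [F_i] have degree [i + d], so for [j != d] there are not even nonzero chains
   of degree [i + j]. *)
have -> : c = 0.
  apply/rowP => b; rewrite [RHS]mxE; apply: c_deg; rewrite degF.
  by apply: contra jd => /eqP/addrI ->.
by exists 0; rewrite mul0mx; split=> // b _; rewrite mxE.
Qed.

End IteratedSyzygies.

(** * Monomial ideals generated in a single degree *)

Section EquigeneratedMonomialIdeals.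
Import GRing.Theory.
Local Open Scope ring_scope.
Variables (k : fieldType) (n : nat).
Local Notation S := {mpoly k[n]}.
Implicit Types (L : 'X_{1..n} -> Prop) (m l : 'X_{1..n}) (s : seq 'X_{1..n}).

Lemma lepm_mdeg_eq l m : (l <= m)%MM -> mdeg l = mdeg m -> l = m.
Proof.
move=> lm /eqP; rewrite -{1 2}(submK lm) mdegD -{1}[mdeg l]add0n eqn_add2r.
by rewrite eq_sym mdeg_eq0 => /eqP ->; rewrite add0m.
Qed.

Lemma mon_ideal_same_deg L d m : (forall l, L l -> mdeg l = d) ->
  mdeg m = d -> mon_ideal (k := k) L 'X_[m] <-> L m.
Proof.
move=> Ld md; split=> [/mon_idealX [l [Ll lm]]|Lm].
  by rewrite -(lepm_mdeg_eq lm) // (Ld _ Ll).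
by apply/mon_idealX; exists m; rewrite lepm_refl.
Qed.

Lemma min_mon_gen_same_deg L d m : (forall l, L l -> mdeg l = d) ->
  min_mon_gen (mon_ideal (k := k) L) m <-> L m.
Proof.
move=> Ld; split=> [[/mon_idealX [l [Ll lm]] m_min]|Lm].
  by rewrite -(m_min l) //; apply/(mon_ideal_same_deg Ld); rewrite ?Ld.
split=> [|m' /mon_idealX [l [Ll lm']] m'm].
  by apply/(mon_ideal_same_deg Ld); rewrite ?Ld.
have lm : l = m by apply: lepm_mdeg_eq (lepm_trans lm' m'm) _; rewrite !Ld.
by apply/mnmP => i; apply/eqP; rewrite eqn_leq -{2}lm !(mnm_lepP _).
Qed.

(** Passes from initial segments of a generator list to row vectors supported on the first [j]
    positions, the form used in [lin_quot_mx]. *)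
Lemma mon_ideal_takeP s j (f : S) :
  mon_ideal (fun m => m \in take j s) f <-> exists w : 'rV[S]_(size s),
    (forall l : 'I_(size s), (j <= l)%N -> w 0 l = 0) /\
    f = (w *m \col_(l < size s) 'X_[nth 0%MM s l]) 0 0.
Proof.
split=> [|[w [w0 ->]]].
  move: f; apply: gen_ideal_ind => [|_ _ [w [w0 ->]] [w' [w'0 ->]]|p _ [m [ms ->]]].
  - by exists 0; split=> [l _|]; rewrite ?mul0mx mxE.
  - exists (w + w'); split=> [l jl|]; last by rewrite mulmxDl [RHS]mxE.
    by rewrite mxE w0 ?w'0 ?addr0.
  - have := ms; rewrite -index_mem size_take_min leq_min => /andP[i_j i_s].
    exists (p *: delta_mx 0 (Ordinal i_s)); split=> [l jl|].
      rewrite !mxE eqxx /=; case: eqP => [il|_]; last exact: mulr0.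
      by move: jl; rewrite il /= leqNgt i_j.
    by rewrite -scalemxAl -rowE !mxE /= -(nth_take (n0 := j)) ?nth_index.
rewrite mxE; apply: gen_ideal_sum => l _; rewrite mxE.
have [/w0 ->|lj] := leqP j l; first by rewrite mul0r; apply: gen_ideal0.
apply: gen_idealM; apply: mem_gen_ideal; exists (nth 0%MM s l); split=> //.
by rewrite -(nth_take (n0 := j)) // mem_nth // size_take_min leq_min lj /=.
Qed.

Lemma linear_quotients_resolution L d : (forall l, L l -> mdeg l = d) ->
  linear_quotients (mon_ideal (k := k) L) -> linear_resolution (mon_ideal (k := k) L) d.
Proof.
move=> Ld [s [s_uniq s_gen s_quot]].
have sL m : m \in s <-> L m.
  by split=> [/s_gen|] /(min_mon_gen_same_deg m Ld) // /s_gen.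
pose M : 'cV[S]_(size s) := \col_l 'X_[nth 0%MM s l].
have [V VP] : exists V : 'I_(size s) -> {set 'I_n}, forall (j : 'I_(size s)) f,
    colon_mon (mon_ideal (fun m => m \in take j s)) (nth 0%MM s j) f
      <-> var_ideal (k := k) (V j) f.
  apply: (fin_all_exists (P := fun (j : 'I_(size s)) V => forall f,
    colon_mon (mon_ideal (fun m => m \in take j s)) (nth 0%MM s j) f
      <-> var_ideal (k := k) V f)) => j.
  (* [linear_quotients] speaks of positions [0 < i] only; at position [0] the colon ideal is zero
     and [V] is empty. *)
  have [j0|j_gt0] := posnP j; last by apply: s_quot; rewrite j_gt0 ltn_ord.
  exists set0 => f; rewrite j0 take0; split=> [/mon_idealP fX|/var_idealP f0].
    apply/var_idealP => m mf; have [|l []//] := fX (nth 0%MM s 0 + m)%MM.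
    by rewrite mcoeff_msupp mcoeffMX -mcoeff_msupp.
  apply/mon_idealP => m /msupp_mulX [_ /f0 [i []]].
  by rewrite inE.
apply: (@lin_quot_linear_resolution k n _ d (size s) M (fun j => j : nat) V).
- split=> [|j f]; first exact: val_inj.
  rewrite -VP /colon_mon; split=> [[w [w0 fM]]|/mon_ideal_takeP [w [w0 fX]]].
    apply/mon_ideal_takeP; exists w; split=> //.
    by rewrite -fM !mxE.
  exists w; split=> //; apply/rowP => b.
  by rewrite (ord1 b) -fX !mxE.
- move=> a b; rewrite mxE -(Ld (nth 0%MM s a)); first exact: zhomogX.
  by apply/sL; rewrite mem_nth.
- move=> f; have := mon_ideal_takeP s (size s) f; rewrite take_size => sP.
  split=> [/(eq_mon_ideal sL)/sP [w [_ ->]]|[w def_f]]; first by exists w.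
  apply/(eq_mon_ideal sL)/sP; exists w; split=> // l.
  by rewrite leqNgt ltn_ord.
Qed.

End EquigeneratedMonomialIdeals.

(** * Koszul homology and Tor *)

Section KoszulComplex.
Import GRing.Theory.
Local Open Scope ring_scope.
Variables (k : fieldType) (n : nat).
Local Notation S := {mpoly k[n]}.
Implicit Types (p : S) (m : 'X_{1..n}) (i j l : 'I_n) (T : {set 'I_n}).

Definition low i m := [forall l : 'I_n, (l < i)%N ==> (m l == 0%N)].

Lemma lowP i m : reflect (forall l, (l < i)%N -> m l = 0%N) (low i m).
Proof.
by apply: (iffP forallP) => lo l; [move/(implyP (lo l))/eqP|apply/implyP => /lo ->].
Qed.

(* The monomials of [p] whose first variable is ['X_i], divided by it; the
   contracting homotopy of the Koszul complex is built from these maps. *)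
Definition first_div i p : S :=
  \sum_(m : 'X_{1..n < msize p})
    (if low i m then p@_(m + U_(i))%MM else 0) *: 'X_[m].

Lemma mcoeff_first_div i p m :
  (first_div i p)@_m = if low i m then p@_(m + U_(i))%MM else 0.
Proof.
have [lt_mp|le_pm] := ltnP (mdeg m) (msize p).
  exact: (mcoeff_mpoly (fun m => if low i m then p@_(m + U_(i))%MM else 0)).
rewrite (memN_msupp_eq0 (m := (m + U_(i))%MM)) ?if_same; last first.
  by apply: msize_mdeg_ge; rewrite mdegD (leq_trans le_pm) ?leq_addr.
rewrite raddf_sum big1 // => m' _; rewrite /= mcoeffZ mcoeffX.
case: eqP => [def_m|_]; last by rewrite mulr0.
by have := bmdeg m'; rewrite def_m ltnNge le_pm.
Qed.

Lemma first_div_is_additive i : additive (first_div i).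
Proof.
move=> p q; apply/mpolyP => m; rewrite mcoeffB !mcoeff_first_div mcoeffB.
by case: ifP; rewrite ?subr0.
Qed.

HB.instance Definition _ i := GRing.isAdditive.Build _ _ _ (first_div_is_additive i).

Lemma first_div_mulX_lt i j p : (j < i)%N -> first_div i (p * 'X_j) = 0.
Proof.
move=> ji; apply/mpolyP => m; rewrite mcoeff_first_div mcoeff_mulX mcoeff0.
case: lowP => // /(_ j ji) mj0; rewrite lep1mP mnmDE mj0 mnm1E.
by have -> : (i == j) = false by rewrite -val_eqE gtn_eqF.
Qed.

Lemma first_div_mulX_gt i j p : (i < j)%N -> first_div i (p * 'X_j) = first_div i p * 'X_j.
Proof.
move=> ij; apply/mpolyP => m; have ji : (i == j) = false by rewrite -val_eqE ltn_eqF.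
rewrite mcoeff_first_div !mcoeff_mulX mcoeff_first_div.
rewrite !lep1mP mnmDE mnm1E ji addn0; case: (m j =P 0%N) => [_|/eqP mj].
  by rewrite if_same.
have -> : low i (m - U_(j))%MM = low i m.
  apply/lowP/lowP => lo l li; have := lo l li; rewrite mnmBE mnm1E.
    by rewrite -val_eqE gtn_eqF ?subn0 // (ltn_trans li).
  by move=> ->.
by rewrite ![(_ + U_(i))%MM]addmC addmBA ?lep1mP.
Qed.

Lemma mcoeff_first_divX j p m :
  (first_div j p * 'X_j)@_m = if (m j != 0%N) && low j m then p@_m else 0.
Proof.
rewrite mcoeff_mulX lep1mP; case: (altP (m j =P 0%N)) => //= mj.
rewrite mcoeff_first_div submK ?lep1mP //; congr (if _ then _ else _).
apply/lowP/lowP => lo l lj; have := lo l lj; rewrite mnmBE mnm1E.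
  by rewrite -val_eqE gtn_eqF // subn0.
by move=> ->.
Qed.

Lemma first_var_uniq i j m : (m i != 0)%N -> low i m -> (m j != 0)%N -> low j m -> i = j.
Proof.
move=> mi /lowP li mj /lowP lj; apply/val_inj/eqP.
rewrite eqn_leq; apply/andP; split; rewrite leqNgt; apply/negP.
  by move=> /li /eqP; rewrite (negbTE mj).
by move=> /lj /eqP; rewrite (negbTE mi).
Qed.

(** Each monomial is produced by one index only, that of its first variable. As [A] is closed
    downwards, this index lies in [A] as soon as some variable of the monomial does. *)
Lemma sum_first_divX (A : pred 'I_n) p m :
  (forall i j, A j -> (i < j)%N -> A i) ->
  (\sum_(j | A j) first_div j p * 'X_j)@_m
    = if [exists j, A j && (m j != 0%N)] then p@_m else 0.
Proof.
move=> A_down; rewrite raddf_sum /=.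
under eq_bigr => j _ do rewrite mcoeff_first_divX.
case: existsP => [[j0 Amj0]|noj]; last first.
  rewrite big1 // => j Aj; case: andP => // -[mj _]; case: noj; exists j.
  by rewrite Aj.
have [j /andP[Aj mj] jmin] := arg_minnP (P := fun j => A j && (m j != 0%N))
  (fun j : 'I_n => j : nat) Amj0.
have lo : low j m.
  apply/lowP => l lj; apply/eqP; apply: contraTT lj => ml.
  have [Al|Al] := boolP (A l); first by rewrite -leqNgt jmin // Al.
  by apply: contra Al => /(A_down _ _ Aj).
rewrite (bigD1 j) //= mj lo big1 ?addr0 // => i /andP[_ ij].
case: andP => // -[mi li]; rewrite (first_var_uniq mi li mj lo) eqxx in ij => //.
Qed.

Lemma first_div_decomp0 p : p = (p@_0%MM)%:MP + \sum_j first_div j p * 'X_j.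
Proof.
apply/mpolyP => m; rewrite mcoeffD mcoeffC sum_first_divX //.
have [->|m0] := eqVneq m 0%MM.
  rewrite mulr1 ifN ?addr0 //; apply/existsP => -[j].
  by rewrite mnm0E eqxx.
rewrite mulr0 add0r ifT //; apply: contraR m0 => /existsPn m0.
by apply/eqP/mnmP => j; rewrite mnm0E; apply/eqP; apply: contraR (m0 j).
Qed.

(** The monomials without a variable before ['X_i] form the first summand; the others are sorted by
    their first variable. *)
Lemma first_div_decomp i p :
  p = first_div i (p * 'X_i) + \sum_(j : 'I_n | (j < i)%N) first_div j p * 'X_j.
Proof.
apply/mpolyP => m; rewrite mcoeffD sum_first_divX => [|j l li jl]; last first.
  exact: ltn_trans li.
rewrite mcoeff_first_div mcoeff_mulX lem_addl addmK.
case: lowP => [lo|nlo].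
  rewrite ifN ?addr0 //; apply/existsP => -[j /andP[/lo ->]].
  by rewrite eqxx.
rewrite add0r ifT //; apply: contraT => /existsPn noj; case: nlo => l li.
by apply/eqP; have := noj l; rewrite li negbK.
Qed.

(** The sign of moving the exterior factor [e_j] past the smaller factors of [T]. *)
Definition ksign j T : S := (-1) ^+ #|[set i in T | (i < j)%N]|.

Lemma first_div_ksign i j T p :
  first_div i (ksign j T * 'X_j * p) = ksign j T * first_div i (p * 'X_j).
Proof. by rewrite -mulrA raddfMsign [p * _]mulrC. Qed.

Section Chains.
Variable r : nat.
Implicit Types (c b : {set 'I_n} -> 'rV[S]_r).

(* Chains of the Koszul complex of the variables with coefficients in a free
   module: [c T] is the coefficient of the exterior basis element of [T]. *)
Definition kdiff c T : 'rV[S]_r :=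
  \sum_(j | j \notin T) (ksign j T * 'X_j) *: c (j |: T).

Lemma eq_kdiff c b T : c =1 b -> kdiff c T = kdiff b T.
Proof. by move=> cb; apply: eq_bigr => j _; rewrite cb. Qed.

Lemma kdiffB c b T : kdiff (fun U => c U - b U) T = kdiff c T - kdiff b T.
Proof. by rewrite -sumrB; apply: eq_bigr => j _; rewrite scalerBr. Qed.

(** Entries are paired across the diagonal without dividing by 2, so the argument works in every
    characteristic. *)
Lemma antisym_sum0 (V : zmodType) (F : 'I_n -> 'I_n -> V) :
  (forall j, F j j = 0) -> (forall j l, (j < l)%N -> F l j = - F j l) ->
  \sum_j \sum_l F j l = 0.
Proof.
move=> F0 FN; pose G (j l : 'I_n) := if (j < l)%N then F j l else 0.
rewrite (eq_bigr (fun j => \sum_l G j l - \sum_l G l j)) => [|j _].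
  by rewrite sumrB [X in _ - X]exchange_big subrr.
rewrite -sumrB; apply: eq_bigr => l _; rewrite /G.
case: ltngtP => [//|lj|/val_inj ->]; rewrite ?subr0 ?sub0r ?F0 ?subrr ?oppr0 //.
by rewrite -FN // opprK.
Qed.

Lemma ksign_setU1_gt j l T : j \notin T -> (j < l)%N -> ksign l (j |: T) = - ksign l T.
Proof.
move=> jT jl; rewrite /ksign.
have -> : [set i in j |: T | (i < l)%N] = j |: [set i in T | (i < l)%N].
  by apply/setP => i; rewrite !inE; case: eqP => //= ->.
by rewrite cardsU1 inE (negbTE jT) /= add1n exprS mulN1r.
Qed.

Lemma ksign_setU1_lt j l T : (l < j)%N -> ksign l (j |: T) = ksign l T.
Proof.
move=> jl; rewrite /ksign; congr (_ ^+ #|pred_of_set _|).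
by apply/setP => i; rewrite !inE; case: eqP => //= ->; rewrite ltnNge ltnW ?andbF.
Qed.

Lemma ksign_setU1 j l T : j \notin T -> l \notin T -> (j < l)%N ->
  ksign j T * ksign l (j |: T) = - (ksign l T * ksign j (l |: T)).
Proof.
move=> jT lT jl; rewrite ksign_setU1_gt // [ksign j (l |: _)]ksign_setU1_lt //.
by rewrite mulrN mulrC.
Qed.

Lemma kdiff_kdiff c T : kdiff (kdiff c) T = 0.
Proof.
pose F j l := if (j \notin T) && (l \notin j |: T) then
  (ksign j T * 'X_j * (ksign l (j |: T) * 'X_l)) *: c (l |: (j |: T)) else 0.
rewrite /kdiff big_mkcond /= -[RHS](@antisym_sum0 _ F).
- apply: eq_bigr => j _; rewrite /F; case: (j \notin T) => /=; last by rewrite big1.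
  by rewrite scaler_sumr big_mkcond; apply: eq_bigr => l _; rewrite scalerA.
- by move=> j; rewrite /F setU11 andbF.
move=> j l jl; rewrite /F !in_setU1 !negb_or.
have jl' : (j == l) = false by rewrite -val_eqE ltn_eqF.
rewrite [l == j]eq_sym jl' /=.
have [jT|_] := boolP (j \notin T); have [lT|_] := boolP (l \notin T);
  rewrite /= ?oppr0 //.
rewrite setUCA -scaleNr; congr (_ *: _).
have := ksign_setU1 jT lT jl.
move: (ksign j T) (ksign l T) (ksign l _) (ksign j _) => s1 s2 s3 s4 s_eq.
rewrite mulrACA -[s2 * _]opprK -s_eq mulrACA mulNr; congr (- (_ * _)).
exact: mulrC.
Qed.

Definition is_min i T := (i \in T) && [forall l in T, (i <= l)%N].

Lemma is_minP i T : reflect (i \in T /\ forall l, l \in T -> (i <= l)%N) (is_min i T).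
Proof.
by apply: (iffP andP) => -[iT]; [move/forall_inP|move=> ?; split=> //; apply/forall_inP].
Qed.

Lemma is_min_inj i j T : is_min i T -> is_min j T -> i = j.
Proof.
move=> /is_minP [iT mi] /is_minP [jT mj]; apply/val_inj/eqP.
by rewrite eqn_leq mi ?mj.
Qed.

(** The sum has a single term, for the least element of [T], or none when [T] is empty. *)
Definition khom c T : 'rV[S]_r :=
  \sum_(i | is_min i T) map_mx (first_div i) (c (T :\ i)).

Lemma khom_min i c T : is_min i T -> khom c T = map_mx (first_div i) (c (T :\ i)).
Proof.
move=> mi; rewrite /khom (big_pred1 i) // => j /=.
by apply/idP/eqP => [mj|->//]; apply: is_min_inj mj mi.
Qed.

Lemma khom_set0 c : khom c set0 = 0.
Proof. by rewrite /khom big_pred0 // => i; rewrite /is_min inE. Qed.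

Lemma khom_eq0 c T : (forall U, c U = 0) -> khom c T = 0.
Proof. by move=> c0; rewrite /khom big1 // => i _; rewrite c0 map_mx0. Qed.

Lemma ksign_low j T : (forall l, l \in T -> (j <= l)%N) -> ksign j T = 1.
Proof.
move=> mj; rewrite /ksign; suff -> : [set i in T | (i < j)%N] = set0 by rewrite cards0.
by apply/setP => l; rewrite !inE; apply/andP => -[/mj]; rewrite leqNgt => /negbTE ->.
Qed.

Lemma khomotopy0 c : c set0 = kdiff (khom c) set0 + map_mx (fun p => (p@_0%MM)%:MP) (c set0).
Proof.
apply/rowP => a; rewrite [RHS]mxE [X in _ + X]mxE addrC.
rewrite {1}[c set0 0 a]first_div_decomp0; congr (_ + _).
rewrite summxE; apply: eq_big => [j|j _]; first by rewrite inE.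
rewrite mxE ksign_low => [|l]; last by rewrite inE.
rewrite setU0 (@khom_min j) ?setDv ?mxE ?mul1r 1?mulrC //.
by apply/is_minP; rewrite set11; split=> // l; rewrite inE => /eqP ->.
Qed.

(** Let [i] be the least element of [T]. The terms with [j > i] cancel between the two summands by
    the sign rule; those with [j <= i] reassemble [c T] by [first_div_decomp]. *)
Lemma khomotopy c T : T != set0 -> c T = kdiff (khom c) T + khom (kdiff c) T.
Proof.
case/set0Pn => i0 i0T.
have [i iT imin] := arg_minnP (P := mem T) (fun j : 'I_n => j : nat) i0T.
have mi : is_min i T by apply/is_minP.
have {iT imin} [iT imin] := is_minP _ _ mi.
rewrite [X in _ + X](khom_min _ mi); apply/rowP => a.
rewrite mxE [X in _ + X]mxE /kdiff !summxE raddf_sum /=.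
have iTi : i \notin T :\ i by rewrite !inE eqxx.
rewrite [X in _ + X](bigD1 i) //= addrCA.
rewrite mxE setD1K // ksign_low ?mul1r => [|l]; last first.
  by rewrite !inE => /andP[_ /imin].
rewrite mulrC {1}[c T 0 a](first_div_decomp i); congr (_ + _).
rewrite [X in _ + X](eq_bigl (fun j => j \notin T)) => [|j]; last first.
  by rewrite !inE negb_and negbK; case: eqP => [->|_] /=; rewrite ?iT ?andbT.
rewrite -big_split /= [RHS](bigID (fun j : 'I_n => (j < i)%N)) /= [X in _ + X]big1 ?addr0.
  apply: eq_big => [j|j ji].
    by case: (boolP (j \in T)) => //= /imin; rewrite leqNgt => /negbTE.
  have jT l : l \in T -> (j <= l)%N by move=> /imin; apply: leq_trans (ltnW ji).
  have jNT : j \notin T by apply/negP => /imin; rewrite leqNgt ji.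
  rewrite !mxE ksign_low // mul1r (@khom_min j); last first.
    by apply/is_minP; rewrite setU11; split=> // l /setU1P [->|/jT].
  rewrite setU1K // mxE mulrC first_div_ksign first_div_mulX_lt //.
  by rewrite mulr0 addr0.
move=> j /andP[jNT]; rewrite -leqNgt leq_eqVlt => /predU1P[/val_inj ij|ij].
  by rewrite -ij iT in jNT.
rewrite !mxE first_div_ksign first_div_mulX_gt // (@khom_min i); last first.
  by apply/is_minP; rewrite inE iT orbT; split=> // l /setU1P [->|/imin //]; apply: ltnW.
rewrite mxE; have -> : (j |: T) :\ i = j |: T :\ i.
  by apply/setP => l; rewrite !inE; case: (eqVneq l j) => [->|_] //=; rewrite -val_eqE gtn_eqF.
have -> : ksign j T = - ksign j (T :\ i) by rewrite -(ksign_setU1_gt iTi ij) setD1K.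
by rewrite !mulNr -mulrA [X in _ + _ * X]mulrC addNr.
Qed.

(** On cycles [khom] inverts [kdiff], the only obstruction being the constant terms at the empty
    set. *)
Lemma kexact c : (forall T, kdiff c T = 0) -> (forall a, (c set0 0 a)@_0%MM = 0) ->
  forall T, c T = kdiff (khom c) T.
Proof.
move=> dc c0 T; have [->|T0] := eqVneq T set0.
  rewrite {1}[c set0]khomotopy0 [X in _ + X](_ : _ = 0) ?addr0 //.
  by apply/rowP => a; rewrite !mxE c0 mpolyC0.
by rewrite {1}[c T]khomotopy // [X in _ + X]khom_eq0 ?addr0.
Qed.

End Chains.

Lemma kdiff_mulmx q r (c : {set 'I_n} -> 'rV[S]_q) (A : 'M[S]_(q, r)) T :
  kdiff (fun U => c U *m A) T = kdiff c T *m A.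
Proof. by rewrite mulmx_suml; apply: eq_bigr => j _; rewrite scalemxAl. Qed.

End KoszulComplex.

(** * From vanishing of Tor to exactness of Koszul chains with coefficients in the ideal *)

Section KoszulTor.
Import GRing.Theory.
Local Open Scope ring_scope.
Variables (k : fieldType) (n : nat).
Local Notation S := {mpoly k[n]}.

Definition hproj r (deg : 'I_r -> int) (z : int) (w : 'rV[S]_r) : 'rV[S]_r :=
  \row_b hcomp (z - deg b) (w 0 b).

Lemma hproj_homog r (deg : 'I_r -> int) z w b :
  zhomog (z - deg b) (hproj deg z w 0 b).
Proof. by rewrite mxE; apply: zhomog_hcomp. Qed.

Lemma hproj_id r (deg : 'I_r -> int) z (w : 'rV[S]_r) :
  (forall b, zhomog (z - deg b) (w 0 b)) -> hproj deg z w = w.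
Proof. by move=> hw; apply/rowP => b; rewrite mxE hcomp_zhomog. Qed.

Lemma hproj_mulmx q r (deg : 'I_q -> int) (deg' : 'I_r -> int) z
    (w : 'rV[S]_q) (A : 'M[S]_(q, r)) :
  (forall a b, zhomog (deg a - deg' b) (A a b)) ->
  hproj deg' z (w *m A) = hproj deg z w *m A.
Proof.
move=> hA; apply/rowP => b; rewrite !mxE raddf_sum; apply: eq_bigr => a _.
rewrite mxE -(hcompMr _ _ (hA a b)); congr (hcomp _ _).
by rewrite addrA subrK.
Qed.

Lemma kdiff_homog r (deg : 'I_r -> int) z (c : {set 'I_n} -> 'rV[S]_r) :
  (forall (T : {set 'I_n}) b, zhomog (z - #|T|%:Z - deg b) (c T 0 b)) ->
  forall (T : {set 'I_n}) b, zhomog (z - #|T|%:Z - deg b) (kdiff c T 0 b).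
Proof.
move=> hc T b; rewrite summxE; apply: zhomog_sum => j jT; rewrite mxE -mulrA.
apply: zhomog_signM.
have -> : z - #|T|%:Z - deg b = 1 + (z - #|j |: T|%:Z - deg b).
  by rewrite cardsU1 jT; lia.
by apply: zhomogM; [apply: zhomogXU|].
Qed.

Lemma kdiff_card r q (c : {set 'I_n} -> 'rV[S]_r) :
  (forall T : {set 'I_n}, #|T| != q.+1 -> c T = 0) -> forall T : {set 'I_n}, #|T| != q -> kdiff c T = 0.
Proof.
move=> c0 T Tq; rewrite /kdiff big1 // => j jT.
by rewrite c0 ?scaler0 // cardsU1 jT eqSS.
Qed.

Lemma mcoeff0_mulmx q r (w : 'rV[S]_q) (A : 'M[S]_(q, r)) :
  map_mx (mcoeff 0%MM) (w *m A) = map_mx (mcoeff 0%MM) w *m map_mx (mcoeff 0%MM) A.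
Proof. exact: map_mxM. Qed.

Lemma mcoeff0_kdiff r (c : {set 'I_n} -> 'rV[S]_r) T :
  map_mx (mcoeff 0%MM) (kdiff c T) = 0.
Proof.
apply/rowP => b; rewrite !mxE summxE raddf_sum big1 // => j _ /=.
by rewrite mxE !rmorphM /= mcoeffX mnm1_eq0 mulr0 mul0r.
Qed.

Variables (I : S -> Prop) (F : graded_free_resolution I).

(** The invariant of the diagonal chase: it makes [kdiff c] a cycle of the resolution, hence
    liftable one step further. *)
Definition lifts_cycle i : ({set 'I_n} -> 'rV[S]_(res_rank F i)) -> Prop :=
  match i with
  | 0 => fun c => forall T, kdiff (fun U => c U *m res_aug F) T = 0
  | j.+1 => fun c => exists b, forall T, c T *m res_diff F j = kdiff b T
  end.

Lemma res_diff_diff i (w : 'rV[S]_(res_rank F i.+2)) :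
  w *m res_diff F i.+1 *m res_diff F i = 0.
Proof. by apply/(res_exactS (g := F)); exists w. Qed.

Lemma kdiff_lift i c T : lifts_cycle (i := i) c ->
  exists w, kdiff c T = w *m res_diff F i.
Proof.
case: i c => [|i] c /=.
  by move=> dc; apply/(res_exact0 (g := F)); rewrite -kdiff_mulmx.
move=> [b cb]; apply/(res_exactS (g := F)); rewrite -kdiff_mulmx.
by rewrite (eq_kdiff _ cb) kdiff_kdiff.
Qed.

(* Diagonal chase in the double complex of [F] and the Koszul complex: a chain
   of Koszul degree [q] over [F_i] is pushed to [F_(i + q)], where it is a
   boundary modulo the variables by the vanishing of Tor. *)
Lemma tor_zero_chase (z : int) q i (c : {set 'I_n} -> 'rV[S]_(res_rank F i)) :
  tor_zero F (i + q) z ->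
  (forall (T : {set 'I_n}) b, zhomog (z - #|T|%:Z - res_deg b) (c T 0 b)) ->
  (forall T : {set 'I_n}, #|T| != q -> c T = 0) ->
  lifts_cycle c ->
  exists t s, t set0 = 0 /\ forall T, c T = kdiff t T + s T *m res_diff F i.
Proof.
elim: q i c => [|q IHq] i c tor0 hc c0 dc.
  have cN0 (T : {set 'I_n}) : T != set0 -> c T = 0 by move=> T0; apply: c0; rewrite cards_eq0.
  (* In Koszul degree [0] the constant terms of [c set0] form a cycle of the tensor product, because
     a Koszul boundary has no constant terms. *)
  pose w0 := map_mx (mcoeff 0%MM) (c set0); rewrite addn0 in tor0.
  have [||w [_ def_w0]] := tor0 w0.
  - move=> b deg_b; rewrite mxE (@zhomog_mcoeff0 _ _ _ _ (hc set0 b)) //.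
    by rewrite cards0 subr0 subr_eq0 eq_sym.
  - rewrite {}/w0; case: i c {tor0 hc c0 cN0} dc => [|i] c //= [b cb].
    by rewrite /tensor_diff -mcoeff0_mulmx cb mcoeff0_kdiff.
  (* Lifting [w] by constants removes the constant terms of [c set0], as [kexact] demands. *)
  pose s (T : {set 'I_n}) := if T == set0 then map_mx (@mpolyC n k) w else 0.
  have sN0 (T : {set 'I_n}) : T != set0 -> s T = 0 by rewrite /s => /negbTE ->.
  pose g (T : {set 'I_n}) := c T - s T *m res_diff F i.
  exists (khom g), s; split=> [|T]; first exact: khom_set0.
  suff <- : g T = kdiff (khom g) T by rewrite subrK.
  apply: kexact => [U|a].
    rewrite /kdiff big1 // => j _; have jU : j |: U != set0.
      by apply/set0Pn; exists j; apply: setU11.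
    by rewrite /g cN0 // sN0 // mul0mx subr0 scaler0.
  have /rowP/(_ a) : map_mx (mcoeff 0%MM) (g set0) = 0; last by rewrite !mxE.
  have wK : map_mx (mcoeff 0%MM) (s set0) = w.
    by apply/rowP => b; rewrite /s eqxx !mxE mpolyCK.
  by rewrite map_mxB mcoeff0_mulmx -/w0 def_w0 wK subrr.
have [c' c'P] : exists c' : {set 'I_n} -> 'rV[S]_(res_rank F i.+1), forall T,
    [/\ kdiff c T = c' T *m res_diff F i, #|T| != q -> c' T = 0
      & forall b, zhomog (z - #|T|%:Z - res_deg b) (c' T 0 b)].
  apply: (fin_all_exists (P := fun T (w : 'rV[S]_(res_rank F i.+1)) =>
    [/\ kdiff c T = w *m res_diff F i, #|T| != q -> w = 0
      & forall b, zhomog (z - #|T|%:Z - res_deg b) (w 0 b)])) => T.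
  have [Tq|Tq] := eqVneq #|T| q; last first.
    exists 0; split=> // [|b]; last by rewrite mxE; apply: zhomog0.
    by rewrite (kdiff_card c0) // mul0mx.
  have [w def_w] := kdiff_lift T dc.
  (* Projecting the lift to its homogeneous part preserves the equation, since [kdiff c] and the
     differential are homogeneous. *)
  exists (hproj (@res_deg _ _ _ F i.+1) (z - #|T|%:Z) w).
  split=> [|/eqP //|b]; last exact: hproj_homog.
  rewrite -(hproj_mulmx _ _ (@res_diff_homog _ _ _ F i)) -def_w hproj_id //.
  exact: kdiff_homog.
have [|T b|T|/=|t [s [t0 c't]]] := IHq i.+1 c'.
- by rewrite addSnnS.
- by have [_ _] := c'P T.
- by have [_ ? _] := c'P T.
- by exists c => T; have [<-] := c'P T.
(* [t] bounds [c'] up to the next differential, so subtracting its image from [c] leaves a Koszul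
   cycle; [t set0 = 0] secures the condition of [kexact] at the empty set. *)
pose g (T : {set 'I_n}) := c T - t T *m res_diff F i.
exists (khom g), t; split=> [|T]; first exact: khom_set0.
suff <- : g T = kdiff (khom g) T by rewrite subrK.
apply: kexact => [U|a]; last first.
  by rewrite /g t0 mul0mx subr0 c0 ?cards0 // mxE mcoeff0.
rewrite kdiffB kdiff_mulmx; have [-> _ _] := c'P U.
by rewrite c't mulmxDl res_diff_diff addr0 subrr.
Qed.

(** One half of the identification of Tor with the Koszul homology of [I]: lift the cycle to [F_0],
    apply the chase, and push down again, where the augmentation kills the [res_diff] term. *)
Lemma koszul_cycle_boundary (z : int) p (c : {set 'I_n} -> 'rV[S]_1) :
  tor_zero F p z ->
  (forall T, I (c T 0 0)) ->
  (forall T : {set 'I_n}, zhomog (z - #|T|%:Z) (c T 0 0)) ->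
  (forall T : {set 'I_n}, #|T| != p -> c T = 0) ->
  (forall T, kdiff c T = 0) ->
  exists t : {set 'I_n} -> 'rV[S]_1,
    (forall T, I (t T 0 0)) /\ forall T, c T = kdiff t T.
Proof.
move=> tor0 Ic hc c0 dc.
have [w wP] : exists w : {set 'I_n} -> 'rV[S]_(res_rank F 0), forall T,
    [/\ c T = w T *m res_aug F, #|T| != p -> w T = 0
      & forall b, zhomog (z - #|T|%:Z - res_deg b) (w T 0 b)].
  apply: (fin_all_exists (P := fun T (w : 'rV[S]_(res_rank F 0)) =>
    [/\ c T = w *m res_aug F, #|T| != p -> w = 0
      & forall b, zhomog (z - #|T|%:Z - res_deg b) (w 0 b)])) => T.
  have [Tp|Tp] := eqVneq #|T| p; last first.
    exists 0; split=> // [|b]; last by rewrite mxE; apply: zhomog0.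
    by rewrite c0 // mul0mx.
  have [w def_w] := (res_aug_image F _).1 (Ic T).
  have {}def_w : c T = w *m res_aug F by apply/rowP => b; rewrite (ord1 b).
  exists (hproj (@res_deg _ _ _ F 0) (z - #|T|%:Z) w).
  split=> [|/eqP //|b]; last exact: hproj_homog.
  rewrite -(hproj_mulmx (deg' := fun=> 0)) -?def_w ?hproj_id // => [b|a b].
    by rewrite (ord1 b) subr0.
  by rewrite (ord1 b) subr0; apply: res_aug_homog.
have [//|T b|T|T|t [s [_ wt]]] := @tor_zero_chase z p 0 w.
- by have [_ _] := wP T.
- by have [_ ? _] := wP T.
- by rewrite -[RHS](dc T); apply: eq_kdiff => U; have [<-] := wP U.
exists (fun T => t T *m res_aug F); split=> [T|T].
  by apply/(res_aug_image F); exists (t T).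
have [-> _ _] := wP T; rewrite wt mulmxDl kdiff_mulmx.
have /(res_exact0 (g := F)) -> : exists w', s T *m res_diff F 0 = w' *m res_diff F 0.
  by exists (s T).
by rewrite addr0.
Qed.

End KoszulTor.

(** * Lexsegments *)

Section Lexsegments.
Import Order.TTheory.
Variable n : nat.
Implicit Types (m w y u v : 'X_{1..n.+1}) (i j t M s : 'I_n.+1).

Lemma lexleE m1 m2 : mdeg m1 = mdeg m2 -> lexle m1 m2 = (m1 <= m2)%O.
Proof. by move=> deg12; rewrite leEmnm lexi_cons deg12 lexx. Qed.

Lemma lem_ord0 m1 m2 : mdeg m1 = mdeg m2 -> (m1 <= m2)%O -> m1 ord0 <= m2 ord0.
Proof.
move=> deg12; rewrite le_eqVlt => /predU1P[-> //|/(ltmcP deg12) [i eq_lt lt_i]].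
have [i0|i_gt0] := posnP i; last by rewrite (eq_lt ord0).
have -> : ord0 = i by apply/val_inj/esym.
exact: ltnW.
Qed.

Lemma ltm_ord0 m1 m2 : mdeg m1 = mdeg m2 -> m1 ord0 < m2 ord0 -> (m1 < m2)%O.
Proof. by move=> deg12 lt12; apply/(ltmcP deg12); exists ord0 => // j; rewrite ltn0. Qed.

(** Exponent subtraction is truncated, so this trades a factor [x_j] for [x_t] only when
    [0 < w j]. *)
Definition exch w j t := (w - U_(j) + U_(t))%MM.

Lemma exchE w j t i : exch w j t i = w i - (j == i) + (t == i).
Proof. by rewrite mnmDE mnmBE !mnm1E. Qed.

Lemma neq_ord0 i : 0 < i -> (i == ord0) = false.
Proof. by rewrite -val_eqE; apply: gtn_eqF. Qed.

Lemma exch_at0 w j t : 0 < j -> 0 < t -> exch w j t ord0 = w ord0.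
Proof. by move=> j0 t0; rewrite exchE !neq_ord0 // subn0 addn0. Qed.

Lemma exch0_at0 w t : 0 < t -> exch w ord0 t ord0 = (w ord0).-1.
Proof. by move=> t0; rewrite exchE eqxx neq_ord0 // addn0 subn1. Qed.

Lemma exchD w j t : 0 < w j -> (exch w j t + U_(j) = w + U_(t))%MM.
Proof.
move=> wj; rewrite /exch -addmA [(U_(t) + _)%MM]addmC addmA submK //.
by rewrite lep1mP -lt0n.
Qed.

Lemma mdeg_exch w j t : 0 < w j -> mdeg (exch w j t) = mdeg w.
Proof.
by move=> wj; apply/eqP; rewrite -(eqn_add2r 1) -{1}(mdeg1 j) -mdegD exchD // mdegD mdeg1.
Qed.

Lemma ltm_swap m1 m2 i j : (i < j)%N -> (m1 + U_(i) = m2 + U_(j))%MM -> (m1 < m2)%O.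
Proof.
move=> ij m12; have deg12 : mdeg m1 = mdeg m2.
  by apply/eqP; rewrite -(eqn_add2r 1) -{1}(mdeg1 i) -mdegD m12 mdegD mdeg1.
have m12E l : m1 l + (i == l) = m2 l + (j == l).
  by have /mnmP/(_ l) := m12; rewrite !mnmDE !mnm1E.
apply/(ltmcP deg12); exists i => [l li|].
  by have := m12E l; rewrite -!val_eqE !gtn_eqF ?addn0 // (ltn_trans li).
by have := m12E i; rewrite eqxx -val_eqE gtn_eqF // addn0 addn1 => <-.
Qed.

Lemma lem_swap m1 m2 i j : (i <= j)%N -> (m1 + U_(i) = m2 + U_(j))%MM -> (m1 <= m2)%O.
Proof.
rewrite leq_eqVlt => /predU1P[/val_inj ->|ij m12].
  by move/eqP; rewrite eqm_add2r => /eqP ->.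
exact/ltW/(ltm_swap ij).
Qed.

Lemma ltm_exch w j t : t < j -> 0 < w j -> (w < exch w j t)%O.
Proof. by move=> tj wj; apply: (ltm_swap tj); rewrite exchD. Qed.

Lemma exch_ltm w j t : j < t -> 0 < w j -> (exch w j t < w)%O.
Proof. by move=> jt wj; apply: (ltm_swap jt); rewrite exchD. Qed.

Definition last_var M w := (0 < w M) && [forall j : 'I_n.+1, (M < j) ==> (w j == 0)].

Lemma last_varP M w :
  reflect (0 < w M /\ forall j : 'I_n.+1, M < j -> w j = 0) (last_var M w).
Proof.
apply: (iffP andP) => -[wM lastM]; split=> //.
  by move=> j Mj; apply/eqP; apply: (implyP (forallP lastM j)).
by apply/forallP => j; apply/implyP => /lastM ->.
Qed.

Lemma last_var_exists w i : 0 < w i -> exists2 M : 'I_n.+1, i <= M & last_var M w.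
Proof.
move=> wi; have [M wM Mmax] := arg_maxnP (P := fun j => 0 < w j)
  (fun j : 'I_n.+1 => j : nat) wi.
exists M; first exact: Mmax.
apply/last_varP; split=> // j Mj; apply/eqP; rewrite -leqn0 leqNgt.
by apply: contraTN Mj => /Mmax; rewrite -leqNgt.
Qed.

Lemma mdeg_lt_exists m1 m2 i : mdeg m1 = mdeg m2 -> m1 i < m2 i ->
  exists j, m2 j < m1 j.
Proof.
move=> deg12 lt_i; apply/existsP; apply: contraT => /existsPn le12.
suff : mdeg m1 < mdeg m2 by rewrite deg12 ltnn.
rewrite !mdegE (bigD1 i) // [X in _ < X](bigD1 i) //= -addSn leq_add //.
by apply: leq_sum => j _; rewrite leqNgt le12.
Qed.

(** Equal degrees force the deficit of [m1] at [s] to be made up elsewhere, necessarily after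
    [s]. *)
Lemma last_var_after m1 m2 s : mdeg m1 = mdeg m2 ->
  (forall j, j < s -> m1 j = m2 j) -> m1 s < m2 s ->
  exists2 M : 'I_n.+1, s < M & last_var M m1.
Proof.
move=> deg12 eq_lt lt_s; have [j lt_j] := mdeg_lt_exists deg12 lt_s.
have [M jM lastM] := last_var_exists (leq_ltn_trans (leq0n _) lt_j).
exists M => //; apply: leq_trans jM; rewrite ltnNge leq_eqVlt; apply/negP.
case/predU1P => [/val_inj js|/eq_lt js]; first by rewrite js ltnNge ltnW in lt_j.
by rewrite js ltnn in lt_j.
Qed.

(** The strict order in which the generators are listed; [before_eq] is its reflexive form for
    sorting. *)
Definition before w' w :=
  (w' ord0 < w ord0) || (w' ord0 == w ord0) && (w < w')%O.

Section Exchange.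
Variables (d : nat) (u v : 'X_{1..n.+1}).
Hypotheses (hu : mdeg u = d) (hv : mdeg v = d).
Local Notation L := (lexseg d u v).

Lemma lexsegP w : L w <-> [/\ mdeg w = d, (w <= u)%O & (v <= w)%O].
Proof. by rewrite /lexseg; split=> -[wd]; rewrite !lexleE ?hu ?hv. Qed.

Definition full_fiber := v ord0 = u ord0 /\ forall w, mdeg w = d -> w ord0 = u ord0 -> L w.

(** Covers both ways of having [b < a]: the second clause is vacuous unless [b + 1 = a]. *)
Definition large_gap := v ord0 < u ord0 /\ forall y M,
  mdeg y = d -> (y < v)%O -> y ord0 = v ord0 -> (v ord0).+1 = u ord0 ->
  0 < M -> last_var M y -> (exch y M ord0 <= u)%O.

Lemma exch_ord0_before w t : 0 < w ord0 -> 0 < t -> before (exch w ord0 t) w.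
Proof.
by move=> w0 t0; rewrite /before exch0_at0 // ltn_predL w0.
Qed.

Lemma exch_before w j t : 0 < t -> t < j -> 0 < w j -> before (exch w j t) w.
Proof.
move=> t0 tj wj; rewrite /before exch_at0 ?(ltn_trans t0 tj) //.
by rewrite eqxx ltm_exch ?orbT //.
Qed.

Lemma last_var_exch0 w M t : t < M -> 0 < t -> last_var M w ->
  last_var M (exch w ord0 t).
Proof.
move=> tM t0 /last_varP [wM lastM]; apply/last_varP; split=> [|j Mj].
  by rewrite exchE eq_sym neq_ord0 ?(ltn_trans t0 tM) // subn0 ltn_addr.
have -> : exch w ord0 t j = w j - (ord0 == j) + (t == j) by rewrite exchE.
by rewrite lastM // -!val_eqE [val t == _]ltn_eqF // (ltn_trans tM).
Qed.

Lemma exch_exch0 w M t : 0 < w ord0 -> t < M -> 0 < t -> 0 < w M ->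
  exch (exch w ord0 t) M ord0 = exch w M t.
Proof.
move=> w0 tM t0 wM; have M0 := ltn_trans t0 tM.
apply/mnmP => i; rewrite !exchE.
case: (eqVneq ord0 i) => [<-|_]; first by rewrite !neq_ord0 //; lia.
case: (eqVneq M i) => [<-|_]; last by lia.
by have -> : (t == M) = false by [rewrite -val_eqE ltn_eqF]; lia.
Qed.

(** The combinatorial core of linear quotients: [x_t w] is a multiple of the earlier generator
    [exch w j t], so [x_t] lies in the colon ideal at [w], and [w t < w' t] makes it divide
    [w' / gcd(w, w')]. *)
Lemma exchange w w' : full_fiber \/ large_gap -> L w -> L w' -> before w' w ->
  exists j t, [/\ w t < w' t, 0 < w j, L (exch w j t) & before (exch w j t) w].
Proof.
move=> cond /lexsegP [wd wu vw] /lexsegP [w'd w'u vw'].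
have deg_ww' : mdeg w = mdeg w' by rewrite wd.
have w0u := lem_ord0 (etrans wd (esym hu)) wu.
have v0w' := lem_ord0 (etrans hv (esym w'd)) vw'.
case/orP => [lt0|/andP[/eqP eq0 /(ltmcP deg_ww') [s eq_lt lt_s]]]; last first.
  have s0 : 0 < s.
    rewrite lt0n; apply/eqP => s0; have s_ord0 : s = ord0 by apply: val_inj.
    by move: lt_s; rewrite s_ord0 eq0 ltnn.
  (* With equal first exponents, [s] is the first difference and [M] the last variable of [w].
     Trading [M] for [s] works unless it overshoots [u]. *)
  have [M sM lastM] := last_var_after deg_ww' eq_lt lt_s.
  have [wM _] := last_varP _ _ lastM.
  have w1d : mdeg (exch w M s) = d by rewrite mdeg_exch.
  have w1_ord0 : exch w M s ord0 = w ord0.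
    by rewrite exch_at0 // (ltn_trans s0 sM).
  have Lw1 : (exch w M s <= u)%O -> L (exch w M s).
    by move=> ?; apply/lexsegP; split=> //; apply: le_trans vw (ltW (ltm_exch sM wM)).
  have [w1u|u_w1] := leP (exch w M s) u.
    by exists M, s; split=> //; [apply: Lw1|apply: exch_before].
  have w0 : w ord0 = u ord0.
    apply/eqP; rewrite eqn_leq w0u -w1_ord0.
    by apply: lem_ord0 (ltW u_w1); rewrite w1d.
  case: cond => [[v0u full]|[gap cond]].
    by exists M, s; split=> //; [apply: full; rewrite ?w1_ord0|apply: exch_before].
  have w_gt0 : 0 < w ord0 by rewrite w0 (leq_ltn_trans _ gap).
  (* After an overshoot, [ord0] is traded for [s] instead. If this falls below [v], then
     [b + 1 = a], and [large_gap] for [exch w ord0 s] bounds [exch w M s] by [u] after all. *)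
  have [v_w2|w2_v] := leP v (exch w ord0 s).
    exists ord0, s; split=> //; last exact: exch_ord0_before.
    apply/lexsegP; split; rewrite ?mdeg_exch //.
    by apply: le_trans wu; apply/ltW/exch_ltm.
  have w2d : mdeg (exch w ord0 s) = d by rewrite mdeg_exch.
  have w2_ord0 : exch w ord0 s ord0 = (w ord0).-1.
    exact: exch0_at0.
  have := lem_ord0 (etrans w2d (esym hv)) (ltW w2_v); rewrite w2_ord0 w0 => le_v0.
  have v_eq : v ord0 = (w ord0).-1 by move: gap; rewrite w0; lia.
  have : (exch (exch w ord0 s) M ord0 <= u)%O.
    apply: cond => //; first by rewrite w2_ord0.
    - by move: w_gt0; rewrite -w0 v_eq; lia.
    - exact: ltn_trans sM.
    - exact: last_var_exch0.
  by rewrite exch_exch0 // leNgt u_w1.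
have [r lt_r] : exists r, w r < w' r.
  exact: mdeg_lt_exists (esym deg_ww') lt0.
(* Here [w'] has the smaller first exponent, so it exceeds [w] somewhere; [t] is the least such
   index. Trading [ord0] for [t] works unless it falls below [v]. *)
have [t lt_t tmin] := arg_minnP (P := fun t => w t < w' t)
  (fun t : 'I_n.+1 => t : nat) lt_r.
have t0 : 0 < t.
  rewrite lt0n; apply/eqP => t0; have t_ord0 : t = ord0 by apply: val_inj.
  by move: lt_t; rewrite t_ord0 ltnNge ltnW.
have w_gt0 : 0 < w ord0 by apply: leq_ltn_trans lt0.
have w2d : mdeg (exch w ord0 t) = d by rewrite mdeg_exch.
have [v_w2|w2_v] := leP v (exch w ord0 t).
  exists ord0, t; split=> //; last exact: exch_ord0_before.
  apply/lexsegP; split=> //.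
  by apply: le_trans wu; apply/ltW/exch_ltm.
have w2_ord0 : exch w ord0 t ord0 = (w ord0).-1.
  exact: exch0_at0.
have v_eq : v ord0 = (w ord0).-1.
  have := lem_ord0 (etrans w2d (esym hv)) (ltW w2_v); rewrite w2_ord0; lia.
case: cond => [[v0u full]|[gap cond]].
  by move: v_eq w0u w_gt0; rewrite v0u; lia.
have deg2 : mdeg (exch w ord0 t) = mdeg w' by rewrite w2d.
have [s eq_lt lt_s] := ltmcP deg2 (lt_le_trans w2_v vw').
(* By minimality of [t], [w'] cannot exceed [exch w ord0 t] before [t]. So the last variable [M] of
   that monomial lies beyond [t], and [M] is traded for [t]. *)
have ts : t <= s.
  rewrite leqNgt; apply/negP => st; move: lt_s; rewrite exchE.
  have -> : (t == s) = false by rewrite -val_eqE gtn_eqF.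
  case: (eqVneq ord0 s) => [<-|_]; first by move: lt0; lia.
  by rewrite subn0 addn0 => /tmin; rewrite leqNgt st.
have [M sM lastM] := last_var_after deg2 eq_lt lt_s.
have tM := leq_ltn_trans ts sM.
have wM : 0 < w M.
  have [] := last_varP _ _ lastM; rewrite exchE eq_sym neq_ord0 ?(ltn_trans t0 tM) //.
  by rewrite -val_eqE ltn_eqF // subn0 addn0.
exists M, t; split=> //; last exact: exch_before.
apply/lexsegP; split; [by rewrite mdeg_exch| |exact: le_trans vw (ltW (ltm_exch tM wM))].
have [eq_u|ne_u] := eqVneq (v ord0).+1 (u ord0).
  rewrite -exch_exch0 //; apply: cond => //; last exact: leq_trans t0 (ltnW tM).
  by rewrite w2_ord0.
apply/ltW/ltm_ord0; first by rewrite mdeg_exch // wd.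
rewrite exch_at0 ?(ltn_trans t0 tM) //; move: ne_u v_eq w_gt0; lia.
Qed.

End Exchange.
End Lexsegments.

(** * Linear quotients from the exchange property *)

Section LexsegmentQuotients.
Import Order.TTheory GRing.Theory.
Variables (k : fieldType) (n d : nat) (u v : 'X_{1..n.+1}).
Hypotheses (hu : mdeg u = d) (hv : mdeg v = d).
Local Notation L := (lexseg d u v).
Implicit Types (m w : 'X_{1..n.+1}).

Definition before_eq w' w :=
  (w' ord0 < w ord0) || (w' ord0 == w ord0) && (w <= w')%O.

Lemma before_eq_refl : reflexive before_eq.
Proof. by move=> w; rewrite /before_eq eqxx lexx orbT. Qed.

Lemma before_eq_total : total before_eq.
Proof. by move=> w w'; rewrite /before_eq; case: ltngtP => //= _; apply: le_total. Qed.

Lemma before_eq_trans : transitive before_eq.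
Proof.
move=> w2 w1 w3; rewrite /before_eq.
case: (ltngtP (w1 ord0)) => //= [lt12 _|-> le21].
  by case/orP => [/(ltn_trans lt12) ->//|/andP[/eqP <- _]]; rewrite lt12.
case: ltngtP => //= _ le32; exact: le_trans le32 le21.
Qed.

Lemma before_eqE w' w : before_eq w' w -> w' != w -> before w' w.
Proof.
rewrite /before /before_eq; case: ltngtP => //= _.
by rewrite le_eqVlt eq_sym => /orP[->|].
Qed.

Lemma before_asym w' w : before w' w -> ~~ before_eq w w'.
Proof.
rewrite /before /before_eq; case: ltngtP => //= _.
by rewrite -ltNge.
Qed.

Definition lexseg_enum : seq 'X_{1..n.+1} :=
  sort before_eq [seq m <- [seq val m | m : 'X_{1..n.+1 < d.+1}] |
    [&& mdeg m == d, (m <= u)%O & (v <= m)%O]].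

Lemma mem_lexseg_enum m : m \in lexseg_enum <-> L m.
Proof.
rewrite (lexsegP hu hv) mem_sort mem_filter; split.
  by case/andP => /and3P[/eqP].
move=> [md mu vm]; rewrite md mu vm eqxx /=.
have m_lt : mdeg m < d.+1 by rewrite md.
by apply/imageP; exists (BMultinom m_lt).
Qed.

Lemma lexseg_enum_uniq : uniq lexseg_enum.
Proof.
rewrite sort_uniq filter_uniq // map_inj_uniq ?enum_uniq //.
exact: val_inj.
Qed.

Lemma mem_take_before s i w : sorted before_eq s -> uniq s -> i < size s ->
  w \in take i s <-> w \in s /\ before w (nth 0%MM s i).
Proof.
move=> s_sorted s_uniq i_s; have le_nth a b : a <= b -> b < size s ->
    before_eq (nth 0%MM s a) (nth 0%MM s b).
  move=> ab b_s; apply: (sorted_leq_nth before_eq_trans before_eq_refl) => //.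
  by rewrite inE (leq_ltn_trans ab).
split=> [w_take|[ws w_before]].
  have ws := mem_take w_take; have idx : index w s < i by rewrite -in_take.
  have w_s : index w s < size s by rewrite index_mem.
  split=> //; apply: before_eqE.
    by rewrite -{1}(nth_index 0%MM ws); apply: le_nth => //; apply: ltnW.
  by rewrite -{1}(nth_index 0%MM ws) nth_uniq // ltn_eqF.
rewrite in_take // ltnNge; apply/negP => le_i.
have := before_asym w_before; rewrite -{1}(nth_index 0%MM ws) le_nth //.
by rewrite index_mem.
Qed.

Lemma lexseg_linear_quotients : full_fiber d u v \/ large_gap d u v ->
  linear_quotients (mon_ideal (k := k) L).
Proof.
move=> cond; have Ld w : L w -> mdeg w = d by case.
exists lexseg_enum; split; first exact: lexseg_enum_uniq.
  by move=> m; split=> [/mem_lexseg_enum|] /(min_mon_gen_same_deg k m Ld) // /mem_lexseg_enum.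
set s := lexseg_enum; move=> i /andP[_ i_s]; set w := nth 0%MM s i.
have s_sorted : sorted before_eq s by apply: sort_sorted before_eq_total _.
have takeP m := mem_take_before m s_sorted lexseg_enum_uniq i_s.
have Lw : L w by apply/mem_lexseg_enum/mem_nth.
(* These are the variables in the colon ideal: an earlier generator divides [x_t w]. They generate
   it by [exchange]. *)
exists [set t | has (fun m => (m <= w + U_(t))%MM) (take i s)] => f.
rewrite /colon_mon; split=> [/mon_idealP fw|/var_idealP fV].
  apply/var_idealP => m mf; have [|w' [/takeP [w's w'w] w'_le]] := fw (w + m)%MM.
    by rewrite mcoeff_msupp mcoeffMX -mcoeff_msupp.
  have Lw' : L w' by apply/mem_lexseg_enum.
  have [j [t [lt_t wj Lw1 w1_before]]] := exchange hu hv cond Lw Lw' w'w.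
  exists t; split.
    rewrite inE; apply/hasP; exists (exch w j t).
      by apply/takeP; split=> //; apply/mem_lexseg_enum.
    by rewrite -(exchD t wj) lem_addr.
  have /mnm_lepP/(_ t) := w'_le; rewrite mnmDE; lia.
apply/mon_idealP => m /msupp_mulX [wm /fV [t []]].
rewrite inE => /hasP [w' w'_take w'_le] mt; exists w'; split=> //.
apply: lepm_trans w'_le _; apply/mnm_lepP => j.
have /mnm_lepP/(_ j) := wm; rewrite mnmDE mnm1E.
by case: eqP => [<-|_]; [move: mt; rewrite mnmBE|]; lia.
Qed.

End LexsegmentQuotients.

(** * Consequences of complete lexsegments and of linear resolutions *)

Section Necessity.
Import Order.TTheory GRing.Theory.
Variables (k : fieldType) (n d : nat) (u v : 'X_{1..n.+1}).
Hypotheses (hu : mdeg u = d) (hv : mdeg v = d) (vu : (v <= u)%O).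
Local Notation L := (lexseg d u v).
Local Notation I := (mon_ideal (k := k) L).
Implicit Types (m w y : 'X_{1..n.+1}) (i j M : 'I_n.+1).

Lemma lexseg_top : L u. Proof. by apply/lexsegP. Qed.

Lemma lexseg_bot : L v. Proof. by apply/lexsegP. Qed.

Lemma eq_shad (K K' : 'X_{1..n.+1} -> Prop) :
  (forall m, K m <-> K' m) -> forall m, shad K m <-> shad K' m.
Proof. by move=> KK' m; split=> -[i [w [/KK' Kw ->]]]; exists i, w. Qed.

Lemma eq_min_mon_gen (K K' : {mpoly k[n.+1]} -> Prop) m :
  (forall f, K f <-> K' f) -> min_mon_gen K m <-> min_mon_gen K' m.
Proof. by move=> KK'; split=> -[/KK' Km m_min]; split=> // m' /KK'; apply: m_min. Qed.

Lemma mem_shad i w : L w -> shad L (U_(i) + w)%MM.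
Proof. by move=> Lw; exists i, w. Qed.

(** The ideal determines its minimal generators, so the set witnessing that it is completely
    lexsegment is [L] itself, and the first shadow of [L] is a lexsegment. *)
Lemma shad_convex m1 m m2 : completely_lexseg_ideal I ->
  shad L m1 -> shad L m2 -> mdeg m = d.+1 -> (m1 <= m)%O -> (m <= m2)%O -> shad L m.
Proof.
move=> [L' [L'seg L'I]].
have L'E m' : L' m' <-> L m'.
  have [d' [u' [v' [_ _ _ L'P]]]] := L'seg 0.
  have L'd w : L' w -> mdeg w = d' by move/L'P => [].
  have Ld w : L w -> mdeg w = d by case.
  rewrite -(min_mon_gen_same_deg k m' L'd) -(min_mon_gen_same_deg k m' Ld).
  exact: iff_sym (eq_min_mon_gen m' L'I).
have shadE := eq_shad L'E.
have shad_deg m' : shad L m' -> mdeg m' = d.+1.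
  by move=> [i [w [[wd _ _] ->]]]; rewrite mdegD mdeg1 wd.
have [d1 [u1 [v1 [u1d v1d _ shadP]]]] := L'seg 1.
move=> Lm1 Lm2 md m1m mm2; apply/shadE/shadP.
have /shadE/shadP [m1d _ v1m1] := Lm1; have /shadE/shadP [m2d m2u1 _] := Lm2.
have d1E : d1 = d.+1 by rewrite -m1d shad_deg.
split; first by rewrite d1E.
  rewrite lexleE ?md ?u1d //; apply: le_trans mm2 _.
  by rewrite -lexleE // m2d u1d.
rewrite lexleE ?md ?v1d //; apply: le_trans m1m.
by rewrite -lexleE // m1d v1d.
Qed.

Hypothesis clex : completely_lexseg_ideal I.

(** If [w > u], the second variable times [w] lies between the second and the first variable times
    [u], hence in the shadow. Comparing first exponents, its divisor in [L] omits a variable other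
    than the first, so it is at least [w]: a contradiction. If [w < v], the first variable times [w]
    is in the shadow, and its divisor in [L] can only be [w]. *)
Lemma full_fiber_of_shad : v ord0 = u ord0 -> full_fiber d u v.
Proof.
move=> v0u; split=> // w wd w0.
have L0 w' : L w' -> w' ord0 = u ord0.
  move/(lexsegP hu hv) => [w'd w'u vw']; apply/eqP.
  by rewrite eqn_leq -{2}v0u !lem_ord0 ?hu ?hv ?w'd.
(* [j1] is the second variable; if there is none, the degree and the first exponent leave a single
   monomial. *)
have [j1 j1_ord|no_j1] := pickP (fun j : 'I_n.+1 => j == 1 :> nat); last first.
  have n0 : n = 0.
    apply/eqP; rewrite -leqn0 leqNgt; apply/negP => n_gt0.
    by have := no_j1 (Ordinal (n_gt0 : 1 < n.+1)); rewrite eqxx.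
  have -> : w = v; last exact: lexseg_bot.
  apply/mnmP => i; have -> : i = ord0 by apply: val_inj; case: i => i /=; rewrite n0; case: i.
  by rewrite w0 v0u.
have j1_gt0 : 0 < j1 by rewrite (eqP j1_ord).
apply/(lexsegP hu hv); split=> //.
  rewrite leNgt; apply/negP => u_w.
  have [i [w' [Lw' def_w]]] : shad L (U_(j1) + w)%MM.
    apply: (shad_convex clex (mem_shad j1 lexseg_top) (mem_shad ord0 lexseg_top)).
    - by rewrite mdegD mdeg1 wd.
    - by rewrite lemc_add2r ltW.
    - apply/ltW/ltm_ord0; first by rewrite !mdegD !mdeg1 wd hu.
      by rewrite !mnmDE !mnm1E neq_ord0 // eqxx w0.
  have [i0|i_gt0] := posnP i.
    have := congr1 (fun m : 'X_{1..n.+1} => m ord0) def_w.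
    rewrite !mnmDE !mnm1E neq_ord0 // w0 (L0 _ Lw') (_ : i = ord0) ?eqxx; first by lia.
    exact: val_inj.
  have [_ w'u _] := (lexsegP hu hv w').1 Lw'.
  have : (w <= w')%O.
    by apply: (@lem_swap _ _ _ j1 i); [rewrite (eqP j1_ord)|rewrite addmC def_w addmC].
  by rewrite leNgt (le_lt_trans w'u u_w).
rewrite leNgt; apply/negP => w_v.
have [i [w' [Lw' def_w]]] : shad L (U_(ord0) + w)%MM.
  apply: (shad_convex clex (mem_shad j1 lexseg_bot) (mem_shad ord0 lexseg_bot)).
  - by rewrite mdegD mdeg1 wd.
  - apply/ltW/ltm_ord0; first by rewrite !mdegD !mdeg1 wd hv.
    by rewrite !mnmDE !mnm1E neq_ord0 // eqxx w0 v0u.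
  - by rewrite lemc_add2r ltW.
have /mnmP/(_ ord0) := def_w; rewrite !mnmDE !mnm1E (L0 _ Lw') w0 => /addIn.
rewrite eqxx; case: eqP => // i0 _; move/eqP: def_w; rewrite i0 eqm_add2l => /eqP w'E.
by have /(lexsegP hu hv) [_ _] := Lw'; rewrite -w'E leNgt w_v.
Qed.

Local Open Scope ring_scope.

Lemma coef_notin_lexseg f m : I f -> mdeg m = d -> ~ L m -> f@_m = 0.
Proof.
move=> /mon_idealP If md nLm; apply: memN_msupp_eq0; apply/negP => /If [l [Ll lm]].
by apply: nLm; rewrite -(lepm_mdeg_eq lm) // md; case: Ll.
Qed.

(* If [X^y] and [X^w], with [y = x_M w / x_0], are not in [I] whereas [x_0 y] and
   all the [x_j w] with [0 < j <= M] are, then the Koszul boundary of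
   [X^w e_1 /\ ... /\ e_M] has coefficients in [I], but it is not the boundary of
   a chain with coefficients in [I]: its [e_1 /\ ... /\ e_(M-1)] coefficient
   involves [x_0 y], which only the excluded [y] and [w] could produce. *)
Lemma linear_resolution_obstruction y M :
  linear_resolution I d -> mdeg y = d -> (0 < M)%N -> last_var M y ->
  ~ L y -> ~ L (exch y M ord0) ->
  (forall j, (0 < j <= M)%N -> I 'X_[exch y M ord0 + U_(j)]) -> False.
Proof.
move=> [F linF] yd M0 /last_varP [yM lastM] nLy.
set w := exch y M ord0 => nLw IXw.
have wd : mdeg w = d by rewrite mdeg_exch.
have wE : (w + U_(M) = y + U_(ord0))%MM by apply: exchD.
pose Q := [set j : 'I_n.+1 | (0 < j <= M)%N].
pose e (T : {set 'I_n.+1}) : 'rV[{mpoly k[n.+1]}]_1 :=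
  if T == Q then const_mx 'X_[w] else 0.
have MQ : M \in Q by rewrite inE M0 leqnn.
have Q_gt0 : (0 < #|Q|)%N by apply/card_gt0P; exists M.
have e_card (T : {set 'I_n.+1}) : #|T| != #|Q|.-1.+1 -> e T = 0.
  by rewrite prednK // /e; case: (eqVneq T Q) => [->|//]; rewrite eqxx.
pose z : int := d%:Z + #|Q|%:Z.
have e_homog (T : {set 'I_n.+1}) (b : 'I_1) : zhomog (z - #|T|%:Z - 0) (e T 0 b).
  rewrite /e; case: eqP => [->|_]; rewrite !mxE; last exact: zhomog0.
  by rewrite subr0 addrK -wd; apply: zhomogX.
have [|||||t [It dt]] := @koszul_cycle_boundary k n.+1 I F z #|Q|.-1 (kdiff e).
(* The boundary has Koszul degree [#|Q| - 1] and total degree [d + #|Q|], which is one off the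
   linear strand. *)
- have -> : z = #|Q|.-1%:Z + d.+1%:Z by rewrite /z; lia.
  by apply: linF; rewrite eqz_nat; lia.
- move=> T; rewrite summxE; apply: gen_ideal_sum => j jT; rewrite mxE /e.
  case: eqP => [TQ|_]; last by rewrite mxE mulr0; apply: gen_ideal0.
  rewrite mxE -mulrA; apply: gen_idealM; rewrite -mpolyXD addmC; apply: IXw.
  by have := setU11 j T; rewrite TQ inE.
- by move=> T; have := @kdiff_homog _ _ 1 (fun=> 0) z e e_homog T 0; rewrite subr0.
- exact: kdiff_card.
- exact: kdiff_kdiff.
have := dt (Q :\ M); move/rowP/(_ 0)/(congr1 (mcoeff (w + U_(M))%MM)).
have MQM : M \notin Q :\ M by rewrite !inE eqxx.
have lhs : (kdiff e (Q :\ M) 0 0)@_(w + U_(M)) != 0.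
  rewrite summxE (bigD1 M) //= big1 => [|j /andP[jQ jM]].
    rewrite mxE setD1K // /e eqxx mxE addr0 -mulrA -mpolyXD raddfMsign /=.
    by rewrite addmC mcoeffX eqxx mulr1 signr_eq0.
  rewrite mxE /e ifN ?mxE ?mulr0 //; apply: contra jM => /eqP jQM.
  by have := MQ; rewrite -jQM !inE eqxx /= orbF eq_sym.
suff rhs : (kdiff t (Q :\ M) 0 0)@_(w + U_(M)) = 0.
  by move=> lr; move: lhs; rewrite lr rhs eqxx.
rewrite summxE raddf_sum big1 // => j jQM; rewrite /= mxE -mulrA raddfMsign /=.
rewrite [_ * t _ _ _]mulrC mcoeff_mulX lep1mP wE.
case: (eqVneq j ord0) => [->|j0].
  rewrite addmK; case: ifP => _; last by rewrite mulr0.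
  by rewrite (coef_notin_lexseg (It _)) ?mulr0.
case: (eqVneq j M) => [->|jM].
  rewrite -wE addmK; case: ifP => _; last by rewrite mulr0.
  by rewrite (coef_notin_lexseg (It _)) ?mulr0.
(* Any other index lies beyond [M], where [y] has no variable, so [x_j] does not divide [x_0 y]. *)
have Mj : (M < j)%N.
  by move: jQM; rewrite !inE jM /= lt0n -val_eqE in j0 *; rewrite j0 -ltnNge.
by rewrite mnmDE mnm1E lastM // [ord0 == j]eq_sym (negbTE j0) mulr0.
Qed.

Lemma large_gap_of_linear : linear_resolution I d ->
  (v ord0 < u ord0)%N -> large_gap d u v.
Proof.
move=> linI gap; split=> // y0 M0 y0d y0v y00 gap1 M0_gt0 lastM0.
rewrite leNgt; apply/negP => u_w0.
(* Violations are sought among the finitely many monomials of degree at most [d], so a largest one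
   exists. *)
pose fail (y : 'X_{1..n.+1 < d.+1}) := [&& mdeg y == d,
  (y < v :> 'X_{1..n.+1})%O, y ord0 == v ord0 &
  [exists M : 'I_n.+1, [&& (0 < M)%N, last_var M y & (u < exch y M ord0)%O]]].
have y0_lt : (mdeg y0 < d.+1)%N by rewrite y0d.
have fail0 : fail (BMultinom y0_lt).
  rewrite /fail /= y0d eqxx y0v y00 eqxx; apply/existsP; exists M0.
  by rewrite M0_gt0 lastM0.
case: (arg_maxP (fun y : 'X_{1..n.+1 < d.+1} => val y) fail0) => y.
case/and4P => /eqP yd y_v /eqP y_0 /existsP [M /and3P[M_gt0 lastM u_w]] ymax.
have [yM _] := last_varP _ _ lastM.
have wd : mdeg (exch y M ord0) = d by rewrite mdeg_exch.
(* [x_0 y] lies between [x_M v] and [x_0 v], both in the shadow. *)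
have Ly0 : shad L (U_(ord0) + y)%MM.
  apply: (shad_convex clex (mem_shad M lexseg_bot) (mem_shad ord0 lexseg_bot)).
  - by rewrite mdegD mdeg1 yd.
  - apply/ltW/ltm_ord0; first by rewrite !mdegD !mdeg1 yd hv.
    by rewrite !mnmDE !mnm1E neq_ord0 // eqxx y_0.
  - by rewrite lemc_add2r ltW.
apply: (linear_resolution_obstruction linI yd M_gt0 lastM).
- by move/(lexsegP hu hv) => [_ _]; rewrite leNgt y_v.
- by move/(lexsegP hu hv) => [_]; rewrite leNgt u_w.
move=> j /andP[j_gt0]; rewrite leq_eqVlt => /predU1P[/val_inj ->|jM].
  rewrite exchD // addmC; case: Ly0 => i [w [Lw ->]].
  by apply/mon_idealX; exists w; rewrite lem_addl.
have y1d : mdeg (exch y M j) = d by rewrite mdeg_exch.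
have y1_0 : exch y M j ord0 = v ord0 by rewrite exch_at0.
have wE : (exch y M ord0 + U_(j) = exch y M j + U_(ord0))%MM.
  by apply: (@addIm _ U_(M)%MM); rewrite -!addmA ![(_ + U_(M))%MM]addmC
    !addmA !exchD // -!addmA [(U_(j) + _)%MM]addmC.
(* Otherwise [exch y M j] would be a larger violation: its last variable [M1] is at least [j], so
   trading [M1] for [ord0] gives at least [exch y M ord0], which exceeds [u]. *)
have Ly1 : L (exch y M j).
  apply/(lexsegP hu hv); split=> //.
    by apply/ltW/ltm_ord0; rewrite ?y1d ?hu // y1_0.
  rewrite leNgt; apply/negP => y1_v.
  have y1_lt : (mdeg (exch y M j) < d.+1)%N by rewrite y1d.
  have y1j : (0 < exch y M j j)%N.
    by rewrite exchE eqxx addn1.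
  have [M1 jM1 lastM1] := last_var_exists y1j.
  have [y1M1 _] := last_varP _ _ lastM1.
  have : fail (BMultinom y1_lt).
    rewrite /fail /= y1d eqxx y1_v y1_0 eqxx; apply/existsP; exists M1.
    rewrite lastM1 (leq_trans j_gt0 jM1) /=; apply: lt_le_trans u_w _.
    by apply: lem_swap jM1 _; rewrite exchD.
  by move/ymax; rewrite /= leNgt ltm_exch.
rewrite wE; apply/mon_idealX; exists (exch y M j); split=> //.
exact: lem_addr.
Qed.

End Necessity.

Theorem theorem2p1p1 (k : fieldType) (n d : nat) (u v : 'X_{1..n.+1})
    (hd : 2 <= d) (hu : mdeg u = d) (hv : mdeg v = d)
    (hu1 : 0 < u ord0) (huv : lexle v u)
    (hI : completely_lexseg_ideal (mon_ideal (k := k) (lexseg d u v))) :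
  linear_resolution (mon_ideal (k := k) (lexseg d u v)) d
  <-> linear_quotients (mon_ideal (k := k) (lexseg d u v)).
Proof.
have deg_vu : mdeg v = mdeg u by rewrite hv.
have vu : (v <= u)%O by rewrite -lexleE.
split=> [linI|]; last by apply: linear_quotients_resolution => w [].
apply: (lexseg_linear_quotients k hu hv).
have := lem_ord0 deg_vu vu; rewrite leq_eqVlt => /predU1P[v0u|gap].
  by left; apply: (full_fiber_of_shad hu hv vu hI).
by right; apply: (large_gap_of_linear hu hv vu hI).
Qed.
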